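(* Let $\{p_x : x = 0,\pm 1,\pm 2,\ldots\}$ be a probability distribution on the integers and let $F$ be its distribution function. Suppose that there exist a constant $K>0$ and a sequence $\{v_j : j=\pm 1,\pm 2,\ldots\}$ of nonnegative real numbers such that both sequences $\{v_{-j} : j=1,2,\ldots\}$ and $\{v_j : j=1,2,\ldots\}$ are log-convex and $$ K p_x = \begin{cases} \sum_{j=|x|+1}^{\infty} v_{-j} & \text{if } x=-1,-2,\ldots,\\ \sum_{j=x+1}^{\infty} v_j & \text{if } x=1,2,\ldots,\\ \max\left\{\sum_{j=1}^{\infty} v_{-j},\ \sum_{j=1}^{\infty} v_j\right\} & \text{if } x=0. \end{cases} $$ Then $F$ is infinitely divisible.
   Context: A sequence $\{u_j : j=1,2,\ldots\}$ of nonnegative real numbers is called log-convex if $u_{j+1}^2 \le u_j\, u_{j+2}$ for every $j\ge 1$ (zero terms are allowed; in particular the identically zero sequence is log-convex). A distribution function $F$ on $\mathbb{R}$ is infinitely divisible if for every positive integer $n$ there is a distribution function $F_n$ on $\mathbb{R}$ whose $n$-fold convolution with itself equals $F$. *)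

(* Defs.v *)
From HB Require Import structures.
From mathcomp Require Import all_boot all_order all_algebra.
From mathcomp Require Import all_classical all_reals all_analysis.

Set Implicit Arguments.
Unset Strict Implicit.
Unset Printing Implicit Defensive.

Import Order.TTheory GRing.Theory Num.Theory.
Import numFieldNormedType.Exports.

Local Open Scope classical_set_scope.
Local Open Scope ring_scope.

(* Sequences are indexed from 1: the value [u 0] plays no role. *)
Definition log_convex (R : realType) (u : nat -> R) : Prop :=
  forall j : nat, (1 <= j)%N -> u j.+1 ^+ 2 <= u j * u j.+2.

Definition int_distribution (R : realType) (p : int -> R) : Prop :=
  (forall x, 0 <= p x) /\
  \esum_(x in [set: int]) (p x)%:E = 1%:E.

(* For an [int_distribution] the sum is at most 1, so [fine] loses nothing. *)
Definition int_cdf (R : realType) (p : int -> R) (t : R) : R :=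
  fine (\esum_(x in [set x : int | x%:~R <= t]) (p x)%:E).

(* Distribution functions on R are the elements of [cumulativeBounded 0 1]:
   nondecreasing, right-continuous, with limits 0 at -oo and 1 at +oo.
   (H * G)(x) is the integral of H(x - y) dG(y). *)
Definition convolution (R : realType) (H : R -> R)
    (G : cumulativeBounded (0 : R) (1 : R)) (x : R) : R :=
  \int[lebesgue_stieltjes_measure G]_y H (x - y).

(* G * ... * G with n factors, for n >= 1; the value at n = 0 is irrelevant. *)
Definition convolution_power (R : realType) (n : nat)
    (G : cumulativeBounded (0 : R) (1 : R)) : R -> R :=
  iter n.-1 (fun H => convolution H G) G.

(* The case n = 1 forces F itself to be a distribution function. *)
Definition infinitely_divisible (R : realType) (F : R -> R) : Prop :=
  forall n : nat, (0 < n)%N ->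
    exists Fn : cumulativeBounded (0 : R) (1 : R), convolution_power n Fn = F.

(* Main.v *)
Require Import Defs.
From HB Require Import structures.
From mathcomp Require Import all_boot all_order all_algebra.
From mathcomp Require Import all_classical all_reals all_analysis.
From mathcomp Require Import measurable_realfun random_variable.
From mathcomp Require Import ring lra zify.

Set Implicit Arguments.
Unset Strict Implicit.
Unset Printing Implicit Defensive.

Import Order.TTheory GRing.Theory Num.Theory.
Import numFieldNormedType.Exports.

Local Open Scope classical_set_scope.
Local Open Scope ring_scope.

(**
The constant K only rescales. Write r k = p k and l k = p (- k) for the two
tails. The hypothesis makes the decrements r k - r k.+1 and l k - l k.+1, for
k >= 0, two log-convex sequences: they are the v j up to the factor K, and the maximum
taken at 0 can only raise the first decrement of one side, which preserves
log-convexity.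

Such a p has a Wiener-Hopf factorization with nonnegative predictors: there are
phi, psi >= 0 on {1, 2, ...} and sigma >= 0 such that the generating functions
satisfy
  P(z) = sigma / ((1 - phi(z)) (1 - psi(1/z))).
This is enough. If u is the coefficient sequence of 1 / (1 - phi), then for
every m the power series (1 - phi)^(-1/m) has nonnegative coefficients and its
m-th power is u ([renewal_root]). Hence p is the m-th convolution power of
  sigma^(1/m) (1 - phi(z))^(-1/m) (1 - psi(1/z))^(-1/m),
a nonnegative sequence, whose mass must be 1 because the m-th power of that mass
is 1 ([predictors_infinitely_divisible]). The passage from sequences on the
integers to distribution functions identifies the Lebesgue-Stieltjes measure of
a cumulative distribution function with a sum of point masses
([convolution_cdf]).

The predictors come from finite sections. For each n let a be the solution of
  a 0 = 1,  sum_(i <= n) a i * p (k - i) = 0  for 1 <= k <= n,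
and b the solution of the same system for the reflected sequence; Levinson's
recursion passes from n to n + 1 by subtracting a multiple of the reversal of b
from a. The crux is that a i <= 0 for i >= 1 ([levinson_comb_le0]). The multiple
is nonnegative because p is log-convex on each side. Moving continuously from
the old a to the new one, look at the first moment at which some a k, with
1 <= k <= n, vanishes before becoming positive. Equations k and k + 1 of the
system, differenced and combined so as to eliminate the constant term, express
a k as a combination of the other a i with nonnegative coefficients, strictly
positive for i > k; this is where log-convexity of the decrements is used
([zero_propagates]). So the last coefficient a (n + 1) vanishes as well, that
is, the path has not left its starting point; and there the same argument leads
to a geometric tail, for which the step of the recursion is zero. The inequality
is strict only if both tails are positive; a tail that vanishes off the origin
has the trivial predictor and is kept apart.

The entries - a i decrease with n and are at most r i / p 0, so they converge
to phi and the equations pass to the limit: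
  p x = sum_(i >= 1) phi i * p (x - i)  for x >= 1  ([limit_predictor]).
Finally h = p - phi * p lives on the integers <= 0 and satisfies there the
renewal recursion of psi; this makes h a multiple of the reflected coefficients
of 1 / (1 - psi), which is the factorization ([wiener_hopf]).
*)

(** * Sums and convolutions over the integers *)

Section Esum.
Local Open Scope ereal_scope.
Context {R : realType}.

(** The constant may be infinite: convolutions are formed in the extended
reals, where finiteness of the factors is not known beforehand. *)
Lemma esumZl (T : choiceType) (D : set T) (c : \bar R) (f : T -> \bar R) :
  0 <= c -> (forall x, 0 <= f x) ->
  \esum_(x in D) (c * f x) = c * \esum_(x in D) f x.
Proof.
move=> c0 f0.
have H (d : R) (g : T -> \bar R) : (0 <= d)%R -> (forall x, 0 <= g x) ->
    \esum_(x in D) (d%:E * g x) <= d%:E * \esum_(x in D) g x.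
  move=> d0 g0; apply: ge_ereal_sup => _ [X [fX XD] <-].
  rewrite -ge0_mule_fsumr; last by move=> x; exact: g0.
  by apply: lee_wpmul2l => //; apply: ereal_sup_ubound; exists X.
case: c c0 => [r| |] //= r0; last first.
  have [[x Dx fx]|nx] := pselect (exists2 x, D x & 0 < f x); last first.
    have f00 x : D x -> f x = 0.
      move=> Dx; apply/eqP; rewrite eq_le f0 andbT leNgt; apply/negP => fx.
      by apply: nx; exists x.
    rewrite [X in _ = _ * X]esum1// mule0 esum1// => x Dx.
    by rewrite f00// mule0.
  have px : 0 < \esum_(x in D) f x.
    apply: (lt_le_trans fx); rewrite -[leLHS](esum_set1 (a := f) (f0 x)).
    rewrite esum_mkcond [leRHS]esum_mkcond; apply: le_esum => y _.
    case: ifPn => [/set_mem/= ->|_]; first by rewrite mem_set.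
    by case: ifP.
  rewrite gt0_mulye//; apply/eqP; rewrite -leye_eq.
  rewrite -[leLHS](gt0_mulye fx).
  rewrite -[leLHS](esum_set1 (a := fun x => +oo * f x)); last first.
    by rewrite mule_ge0.
  rewrite esum_mkcond [leRHS]esum_mkcond; apply: le_esum => y _.
  case: ifPn => [/set_mem/= ->|_]; first by rewrite mem_set.
  by case: ifP => // _; rewrite mule_ge0.
apply/eqP; rewrite eq_le H//=.
have [->|rn0] := eqVneq r 0%R.
  by rewrite mul0e esum_ge0// => x _; rewrite mul0e.
have rgt0 : (0 < r)%R by rewrite lt_neqAle eq_sym rn0.
have := H r^-1%R (fun x => r%:E * f x).
rewrite invr_ge0 => /(_ r0) /(_ (fun x => mule_ge0 r0 (f0 x))).
under eq_esum do rewrite muleA -EFinM mulVf// mul1e.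
move=> /(@lee_wpmul2l _ r%:E).
rewrite lee_fin => /(_ r0).
by rewrite muleA -EFinM divff// mul1e.
Qed.

Lemma esum_exchange (T1 T2 : choiceType) (f : T1 -> T2 -> \bar R) :
  (forall x y, 0 <= f x y) ->
  \esum_(x in [set: T1]) \esum_(y in [set: T2]) f x y =
  \esum_(y in [set: T2]) \esum_(x in [set: T1]) f x y.
Proof.
move=> f0; rewrite !esum_esum//.
rewrite (reindex_esum (setT `*`` (fun=> setT)) _ (fun z => (z.2, z.1)))//.
split => //= [[a b] [c d] _ _ /= [-> ->]//|[a b] _].
by exists (b, a).
Qed.

Lemma esum_translate (f : int -> \bar R) (a : int) :
  \esum_(x in [set: int]) f x = \esum_(x in [set: int]) f (x + a)%R.
Proof.
apply: reindex_esum; split => //= [x y _ _ /addIr//|x _].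
by exists (x - a)%R => //; rewrite subrK.
Qed.

Lemma esum_reflect (f : int -> \bar R) :
  \esum_(x in [set: int]) f x = \esum_(x in [set: int]) f (- x)%R.
Proof.
apply: reindex_esum; by split => //= x y _ _ /oppr_inj.
Qed.

End Esum.

Section Convolution.
Local Open Scope ereal_scope.
Context {R : realType}.
Implicit Types f g h : int -> \bar R.

Definition int_conv f g (x : int) : \bar R :=
  \esum_(y in [set: int]) (f y * g (x - y)%R).

Definition int_delta (x : int) : \bar R := if x == 0%R then 1 else 0.

Local Notation "f ** g" := (int_conv f g) (at level 40, left associativity).

Lemma int_delta_ge0 x : 0 <= int_delta x.
Proof. by rewrite /int_delta; case: ifP. Qed.

Lemma int_conv_ge0 f g : (forall x, 0 <= f x) -> (forall x, 0 <= g x) ->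
  forall x, 0 <= (f ** g) x.
Proof. by move=> f0 g0 x; apply: esum_ge0 => y _; exact: mule_ge0. Qed.

Lemma int_convC f g : f ** g = g ** f.
Proof.
apply/funext => x; rewrite /int_conv esum_reflect (esum_translate _ (- x)%R).
by apply: eq_esum => y _; rewrite muleC; congr (g _ * f _); lia.
Qed.

(** Tonelli, followed by the substitution z -> z - y. *)
Lemma int_convA f g h : (forall x, 0 <= f x) -> (forall x, 0 <= g x) ->
  (forall x, 0 <= h x) -> f ** (g ** h) = f ** g ** h.
Proof.
move=> f0 g0 h0; apply/funext => x; rewrite /int_conv.
transitivity (\esum_(y in [set: int]) \esum_(z in [set: int])
    (f y * g (z - y)%R * h (x - z)%R)).
  apply: eq_esum => y _; rewrite -esumZl//; last first.
    by move=> z; exact: mule_ge0.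
  rewrite (esum_translate _ (- y)%R); apply: eq_esum => z _.
  by rewrite muleA; congr (_ * h _); lia.
rewrite esum_exchange; last by move=> y z; rewrite !mule_ge0.
apply: eq_esum => z _; rewrite muleC -esumZl//; last first.
  by move=> y; exact: mule_ge0.
by apply: eq_esum => y _; rewrite muleC.
Qed.

Lemma int_convDr f g h : (forall x, 0 <= f x) -> (forall x, 0 <= g x) ->
  (forall x, 0 <= h x) -> f ** (g \+ h) = (f ** g) \+ (f ** h).
Proof.
move=> f0 g0 h0; apply/funext => x; rewrite /int_conv/= -esumD => [|y _|y _].
- by apply: eq_esum => y _; rewrite ge0_muleDr.
- exact: mule_ge0.
- exact: mule_ge0.
Qed.

Lemma int_convZl c f g : 0 <= c -> (forall x, 0 <= f x) ->
  (forall x, 0 <= g x) ->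
  (fun x => c * f x) ** g = fun x => c * (f ** g) x.
Proof.
move=> c0 f0 g0; apply/funext => x; rewrite /int_conv -esumZl//.
  by apply: eq_esum => y _; rewrite muleA.
by move=> y; exact: mule_ge0.
Qed.

Lemma int_conv0f f : (forall x, 0 <= f x) -> int_delta ** f = f.
Proof.
move=> f0; apply/funext => x; rewrite /int_conv.
rewrite -[RHS](esum_set1 (t := 0%R :> int) (a := fun=> f x) (f0 x)).
rewrite [RHS]esum_mkcond.
apply: eq_esum => y _; rewrite /int_delta; case: eqP => [->|y0].
  by rewrite mul1e subr0 mem_set.
by rewrite mul0e memNset.
Qed.

Lemma esum_int_conv f g : (forall x, 0 <= f x) -> (forall x, 0 <= g x) ->
  \esum_(x in [set: int]) (f ** g) x =
  (\esum_(x in [set: int]) f x) * \esum_(x in [set: int]) g x.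
Proof.
move=> f0 g0; rewrite /int_conv esum_exchange; last first.
  by move=> x y; exact: mule_ge0.
rewrite muleC -esumZl//; last exact: esum_ge0.
apply: eq_esum => y _; rewrite esumZl// muleC; congr (_ * _).
by rewrite [RHS](esum_translate _ (- y)%R).
Qed.

End Convolution.

(** * Distribution functions of distributions on the integers *)

Section IntMeasure.
Context {R : realType} (q : int -> R) (hq : int_distribution q).
Local Open Scope ereal_scope.

(** Series of measures are indexed by nat, so the atoms are enumerated, in the
order 0, -1, 1, -2, 2, ... *)
Definition nat_int (n : nat) : int := if odd n then Negz n./2 else Posz n./2.

Lemma nat_int_bij : bijective nat_int.
Proof.
exists (fun x : int => match x with Posz k => k.*2 | Negz k => k.*2.+1 end).
  move=> n; rewrite /nat_int -[RHS]odd_double_half.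
  by case: (odd n); rewrite ?add0n ?add1n.
by case=> k; rewrite /nat_int/= odd_double/= ?uphalf_double ?doubleK.
Qed.

Lemma nneseries_nat_int (f : int -> \bar R) : (forall x, 0 <= f x) ->
  \sum_(n <oo) f (nat_int n) = \esum_(x in [set: int]) f x.
Proof.
move=> f0; rewrite nneseries_esumT//; apply/esym/reindex_esum.
by rewrite setTT_bijective; exact: nat_int_bij.
Qed.

Definition int_measure : set (measurableTypeR R) -> \bar R :=
  mseries (fun n => mscale (NngNum (hq.1 (nat_int n)))
    (dirac ((nat_int n)%:~R : measurableTypeR R))) 0.

HB.instance Definition _ := Measure.on int_measure.

Lemma int_measureE A :
  int_measure A = \esum_(x in [set x | A x%:~R]) (q x)%:E.
Proof.
rewrite /int_measure /mseries /mscale/=.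
rewrite (nneseries_nat_int (f := fun x => (q x)%:E * \d_(x%:~R : R) A)).
  rewrite [RHS]esum_mkcond; apply: eq_esum => x _; rewrite diracE.
  by rewrite (_ : (x \in _) = (x%:~R \in A))//; case: ifP; rewrite ?mule1 ?mule0.
by move=> x; rewrite mule_ge0// lee_fin hq.1.
Qed.

Lemma int_measure_setT : int_measure setT = 1.
Proof. by rewrite int_measureE -[RHS]hq.2. Qed.

HB.instance Definition _ :=
  @Measure_isProbability.Build _ _ _ int_measure int_measure_setT.

Lemma ge0_integral_int_measure (f : measurableTypeR R -> \bar R) :
  measurable_fun [set: measurableTypeR R] f -> (forall x, 0 <= f x) ->
  \int[int_measure]_x f x = \esum_(x in [set: int]) ((q x)%:E * f x%:~R).
Proof.
move=> mf f0; rewrite /int_measure ge0_integral_measure_series//.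
rewrite -(nneseries_nat_int (f := fun x => (q x)%:E * f x%:~R)); last first.
  by move=> x; rewrite mule_ge0// lee_fin hq.1.
apply: eq_eseriesr => n _; rewrite ge0_integral_mscale//=.
by rewrite integral_dirac// diracT mul1e.
Qed.

(** The proof that q is a distribution is an argument, so that the cumulative
function structure below can be inferred from the term. *)
Definition cdf_of & int_distribution q : R -> R := int_cdf q.

Local Notation dist_cdf := (cdf_of hq).

Let idTR : measurableTypeR R -> R := idfun.

#[local] HB.instance Definition _ :=
  @isMeasurableFun.Build _ _ _ _ idTR (@measurable_id _ _ setT).

Let cdfE r : cdf (idTR : {RV int_measure >-> R}) r = (dist_cdf r)%:E.
Proof.
rewrite /cdf /distribution /pushforward preimage_id /cdf_of /int_cdf.
rewrite [RHS](_ : _ = (fine (int_measure `]-oo, r]))%:E).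
  by rewrite fineK// fin_num_measure.
congr ((fine _)%:E); rewrite int_measureE.
by congr esum; apply/seteqP; split => x /=; rewrite in_itv.
Qed.

Let dist_cdfE : dist_cdf = fine \o cdf (idTR : {RV int_measure >-> R}).
Proof.
by apply/funext => r; rewrite [RHS](_ : _ = fine (dist_cdf r)%:E)// -cdfE.
Qed.

Let dist_cdf_nd : nondecreasing dist_cdf.
Proof. move=> x y xy; rewrite -lee_fin -!cdfE; exact: cdf_nondecreasing. Qed.

Let dist_cdf_rc : right_continuous dist_cdf.
Proof.
move=> a; rewrite [X in X @ _ --> _]dist_cdfE; apply: fine_cvg.
by rewrite -cdfE; exact: cdf_right_continuous.
Qed.

HB.instance Definition _ :=
  isCumulative.Build R _ R dist_cdf dist_cdf_nd dist_cdf_rc.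

Let dist_cdf_Ny0 : dist_cdf @ -oo%R --> (0:R)%R.
Proof. by rewrite dist_cdfE; exact/fine_cvg/cvg_cdfNy0. Qed.

Let dist_cdf_y1 : dist_cdf @ +oo%R --> (1:R)%R.
Proof. by rewrite dist_cdfE; exact/fine_cvg/cvg_cdfy1. Qed.

HB.instance Definition _ :=
  isCumulativeBounded.Build R 0%R 1%R dist_cdf dist_cdf_Ny0 dist_cdf_y1.

(** A Lebesgue-Stieltjes measure is determined by its values on half-open
intervals, and there both sides are increments of the distribution function. *)
Lemma lebesgue_stieltjes_cdf_of A : measurable A ->
  lebesgue_stieltjes_measure dist_cdf A = int_measure A.
Proof.
move=> mA; apply: lebesgue_stieltjes_measure_unique => [I [[a b]]/= _ <- | //].
rewrite /lebesgue_stieltjes_measure /measure_extension/=.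
rewrite measurable_mu_extE/=; last exact: is_ocitv.
have [ab | ba] := leP a b; last first.
  by rewrite set_itv_ge ?wlength0 ?measure0// bnd_simp -leNgt ltW.
rewrite wlength_itv_bnd// EFinB -!cdfE.
rewrite /cdf /distribution /pushforward !preimage_id.
have : `]a, b]%classic = `]-oo, b] `\` `]-oo, a] => [|->].
  by rewrite -[RHS]setCK setCD setCitvl setUC -[LHS]setCK setCitv.
rewrite measureD ?setIidr//; first exact: subset_itvl.
by rewrite -ge0_fin_numE// fin_num_measure.
Qed.

End IntMeasure.

Section ConvolutionPower.
Context {R : realType}.
Local Open Scope ereal_scope.
Local Notation "f ** g" := (@int_conv R f g) (at level 40, left associativity).

Definition int_conv_pow (f : int -> \bar R) (n : nat) : int -> \bar R :=
  iter n (int_conv f) int_delta.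

Lemma int_conv_pow_ge0 f n : (forall x, 0 <= f x) ->
  forall x, 0 <= int_conv_pow f n x.
Proof.
by move=> f0; elim: n => [|n ih]; [exact: int_delta_ge0 | exact: int_conv_ge0].
Qed.

Lemma int_convACA f g a b : (forall x, 0 <= f x) -> (forall x, 0 <= g x) ->
  (forall x, 0 <= a x) -> (forall x, 0 <= b x) ->
  f ** g ** (a ** b) = f ** a ** (g ** b).
Proof.
move=> f0 g0 a0 b0; have cp := @int_conv_ge0 R.
rewrite -(int_convA f0 g0) ?(int_convA g0 a0 b0) ?(int_convC g a); last exact: cp.
by rewrite -(int_convA a0 g0 b0) (int_convA f0 a0)//; exact: cp.
Qed.

Lemma int_conv_powM f g n : (forall x, 0 <= f x) -> (forall x, 0 <= g x) ->
  int_conv_pow (f ** g) n = int_conv_pow f n ** int_conv_pow g n.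
Proof.
move=> f0 g0; have cp := int_conv_pow_ge0; elim: n => [|n ih].
  by rewrite int_conv0f//; exact: int_delta_ge0.
by rewrite /= -!/(int_conv_pow _ _) ih int_convACA//; exact: cp.
Qed.

Lemma esum_int_conv_pow f n : (forall x, 0 <= f x) ->
  \esum_(x in [set: int]) int_conv_pow f n x =
  (\esum_(x in [set: int]) f x) ^+ n.
Proof.
move=> f0; elim: n => [|n ih].
  rewrite expe0 -[RHS](esum_set1 (t := 0%R :> int) (a := int_delta)).
    rewrite [RHS]esum_mkcond; apply: eq_esum => y _; rewrite /= /int_delta.
    by case: eqP => [->|y0]; [rewrite mem_set | rewrite memNset].
  exact: int_delta_ge0.
rewrite expeS /= -/(int_conv_pow _ _) esum_int_conv ?ih//.
exact: int_conv_pow_ge0.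
Qed.

Lemma int_distribution_le1 (q : int -> R) (A : set int) :
  int_distribution q -> \esum_(x in A) (q x)%:E <= 1.
Proof.
move=> [q0 <-]; rewrite [leLHS]esum_mkcond; apply: le_esum => x _.
by case: ifP => //; rewrite lee_fin.
Qed.

Lemma int_cdfE (q : int -> R) t : int_distribution q ->
  (int_cdf q t)%:E = \esum_(x in [set x : int | (x%:~R <= t)%R]) (q x)%:E.
Proof.
move=> hq; rewrite fineK// ge0_fin_numE; last first.
  by apply: esum_ge0 => x _; rewrite lee_fin hq.1.
by rewrite (le_lt_trans (int_distribution_le1 _ hq))// ltry.
Qed.

(** Distribution functions convolve as the underlying mass functions do: the
integral against a sum of point masses is a sum over the integers, and the two
sums are exchanged. *)
Lemma convolution_cdf (h q : int -> R) (hh : int_distribution h)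
    (hq : int_distribution q) :
  exists r, [/\ int_distribution r,
    (fun x => (r x)%:E) = (fun x => (h x)%:E) ** (fun x => (q x)%:E) &
    convolution (int_cdf h) (cdf_of hq) = int_cdf r].
Proof.
set H := fun x => (h x)%:E; set Q := fun x => (q x)%:E.
have H0 x : 0 <= H x by rewrite lee_fin hh.1.
have Q0 x : 0 <= Q x by rewrite lee_fin hq.1.
have HQ0 := int_conv_ge0 H0 Q0.
have mass : \esum_(x in [set: int]) (H ** Q) x = 1.
  by rewrite esum_int_conv// hh.2 hq.2 mule1.
pose r x := fine ((H ** Q) x).
have rE : (fun x => (r x)%:E) = H ** Q.
  apply/funext => x; rewrite fineK// ge0_fin_numE//.
  rewrite (@le_lt_trans _ _ 1) ?ltry// -mass.
  rewrite -[leLHS](esum_set1 (HQ0 x)) [leLHS]esum_mkcond; apply: le_esum => y _.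
  by case: ifP.
have hr : int_distribution r.
  split; first by move=> x; rewrite fine_ge0.
  by rewrite -mass -rE.
exists r; split => //; apply/funext => x.
rewrite /convolution /Rintegral [RHS]/int_cdf; congr fine.
have -> : \int[lebesgue_stieltjes_measure (cdf_of hq)]_y
    (int_cdf h (x - y))%:E = \int[int_measure hq]_y (int_cdf h (x - y))%:E.
  apply: eq_measure_integral => A mA _; exact: lebesgue_stieltjes_cdf_of.
have cdf0 t : (0 <= int_cdf h t)%R.
  by rewrite -lee_fin int_cdfE//; apply: esum_ge0 => z _; exact: H0.
rewrite ge0_integral_int_measure; last 2 first.
- apply/measurable_EFinP; apply: nonincreasing_measurable => // s t st.
  rewrite -lee_fin !int_cdfE//; rewrite [leLHS]esum_mkcond [leRHS]esum_mkcond.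
  apply: le_esum => z _; case: ifPn => [/set_mem/= zt|_].
    by rewrite mem_set//= (le_trans zt)// lerD2l lerN2.
  by case: ifP => // _; exact: H0.
- by move=> y; rewrite lee_fin.
pose A : set int := [set z | (z%:~R <= x)%R].
transitivity (\esum_(y in [set: int]) \esum_(z in [set: int])
    (if z \in A then H (z - y)%R * Q y else 0)).
  apply: eq_esum => y _; rewrite int_cdfE// esum_mkcond -esumZl; last 2 first.
  - exact: Q0.
  - by move=> z; case: ifP => // _; exact: H0.
  rewrite [LHS](esum_translate _ (- y)%R); apply: eq_esum => z _ /=.
  rewrite (_ : (_ \in _) = (z \in A)); last first.
    by apply/idP/idP => /set_mem/= zx; apply/mem_set => /=; move: zx;
      rewrite rmorphB/= lerD2r.
  by case: ifP; rewrite ?mule0// muleC.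
rewrite esum_exchange; last by move=> y z; case: ifP => // _; exact: mule_ge0.
rewrite [RHS]esum_mkcond; apply: eq_esum => z _.
have -> : (r z)%:E = (Q ** H) z by rewrite int_convC -rE.
rewrite /int_conv.
by case: ifP => zA; [apply: eq_esum => y _; rewrite muleC|rewrite esum1].
Qed.

Lemma convolution_power_cdf (q : int -> R) (hq : int_distribution q) (n : nat) :
  exists r, [/\ int_distribution r,
    (fun x => (r x)%:E) = int_conv_pow (fun x => (q x)%:E) n.+1 &
    convolution_power n.+1 (cdf_of hq) = int_cdf r].
Proof.
elim: n => [|n [r [hr rE rn]]].
  exists q; split => //=; rewrite int_convC int_conv0f// => x.
  by rewrite lee_fin hq.1.
have [s [hs sE sn]] := convolution_cdf hr hq.
exists s; split => //; first by rewrite sE rE int_convC.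
by rewrite -sn -rn.
Qed.

End ConvolutionPower.

(** * Convolution roots of renewal sequences *)

Section SequenceConvolution.
Context {R : realType}.
Implicit Types f g h u : nat -> R.

Definition seq_conv f g (k : nat) : R := \sum_(i < k.+1) f i * g (k - i)%N.

Definition seq_delta (k : nat) : R := (k == 0)%:R.

(** The operator z d/dz on generating functions. *)
Definition euler_deriv f (k : nat) : R := k%:R * f k.

Local Notation "f ** g" := (seq_conv f g) (at level 40, left associativity).

Let coef_seq_conv n f g k : (k < n)%N ->
  (f ** g) k = ((\poly_(i < n) f i) * (\poly_(i < n) g i))`_k.
Proof.
move=> kn; rewrite coefM; apply: eq_bigr => i _.
have ik : (i <= k)%N by rewrite -ltnS.
by rewrite !coef_poly (leq_ltn_trans ik kn) (leq_ltn_trans (leq_subr _ _) kn).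
Qed.

Lemma seq_convC f g : f ** g = g ** f.
Proof. by apply/funext => k; rewrite !(@coef_seq_conv k.+1)// mulrC. Qed.

Lemma seq_convA f g h : f ** (g ** h) = f ** g ** h.
Proof.
apply/funext => k.
rewrite [LHS](@coef_seq_conv k.+1)// [RHS](@coef_seq_conv k.+1)//.
transitivity (((\poly_(i < k.+1) f i) * ((\poly_(i < k.+1) g i) *
  (\poly_(i < k.+1) h i)))`_k).
  rewrite !coefM; apply: eq_bigr => i _; congr (_ * _).
  have ik : (k - i < k.+1)%N by rewrite ltnS leq_subr.
  by rewrite coef_poly ik (coef_seq_conv _ _ ik).
rewrite mulrA !coefM; apply: eq_bigr => i _; congr (_ * _).
by rewrite coef_poly ltn_ord (coef_seq_conv _ _ (ltn_ord i)).
Qed.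

Lemma seq_convDl f g h k :
  ((fun i => f i + g i) ** h) k = (f ** h) k + (g ** h) k.
Proof. by rewrite -big_split; apply: eq_bigr => i _; rewrite mulrDl. Qed.

Lemma seq_convZl c f g k : ((fun i => c * f i) ** g) k = c * (f ** g) k.
Proof.
by rewrite /seq_conv big_distrr; apply: eq_bigr => i _ /=; rewrite mulrA.
Qed.

Lemma seq_conv0f f : seq_delta ** f = f.
Proof.
apply/funext => k; rewrite /seq_conv big_ord_recl/= subn0 mul1r big1 ?addr0// => i _.
by rewrite mul0r.
Qed.

Lemma seq_conv_ge0 f g : (forall k, 0 <= f k) -> (forall k, 0 <= g k) ->
  forall k, 0 <= (f ** g) k.
Proof. by move=> f0 g0 k; apply: sumr_ge0 => i _; exact: mulr_ge0. Qed.

Lemma euler_derivM f g k :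
  euler_deriv (f ** g) k = (euler_deriv f ** g) k + (f ** euler_deriv g) k.
Proof.
rewrite /euler_deriv /seq_conv big_distrr -big_split; apply: eq_bigr => i _ /=.
have ik : (i <= k)%N by rewrite -ltnS.
by rewrite -{1}(subnKC ik) natrD; ring.
Qed.

Lemma seq_conv_recl f g k : f 0 = 0 ->
  (f ** g) k = \sum_(i < k) f i.+1 * g (k - i.+1)%N.
Proof. by move=> f0; rewrite /seq_conv big_ord_recl f0 mul0r add0r. Qed.

(** Course-of-values recursion: s n below lists the first n + 1 values. *)
Lemma weighted_recursion (w : nat -> nat -> R) : exists u : nat -> R,
  u 0 = 1 /\ forall k, u k.+1 = \sum_(i < k.+1) w k i * u (k - i)%N.
Proof.
pose s := fix s n := if n is n'.+1 then
  rcons (s n') (\sum_(i < n'.+1) w n' i * nth 0 (s n') (n' - i)%N) else [:: 1].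
have szs n : size (s n) = n.+1 by elim: n => //= n ih; rewrite size_rcons ih.
have sle m n : (m <= n)%N -> nth 0 (s n) m = nth 0 (s m) m.
  elim: n => [|n ih]; first by rewrite leqn0 => /eqP ->.
  rewrite leq_eqVlt => /predU1P[->//|mn] /=.
  by rewrite nth_rcons szs mn ih.
exists (fun n => nth 0 (s n) n); split => // k.
rewrite [LHS]/= nth_rcons szs ltnn eqxx; apply: eq_bigr => i _.
by rewrite sle// leq_subr.
Qed.

(** In generating functions u = 1 / (1 - phi). *)
Lemma renewal_exists (phi : nat -> R) : phi 0 = 0 ->
  exists u : nat -> R, forall k, u k = seq_delta k + (phi ** u) k.
Proof.
move=> phi0; have [u [u0 uS]] := weighted_recursion (fun _ i => phi i.+1).
exists u => -[|k]; rewrite seq_conv_recl//; first by rewrite big_ord0 u0 addr0.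
by rewrite uS add0r; apply: eq_bigr => i _; rewrite subSS.
Qed.

Lemma renewal_ge0 (phi u : nat -> R) :
  phi 0 = 0 -> (forall k, 0 <= phi k) ->
  (forall k, u k = seq_delta k + (phi ** u) k) -> forall k, 0 <= u k.
Proof.
move=> phi0 phige0 uE k; have [n] := ubnP k; elim: n k => // n ih k kn.
rewrite uE seq_conv_recl// addr_ge0 ?ler0n// sumr_ge0// => i _.
by rewrite mulr_ge0// ih//; have := ltn_ord i; lia.
Qed.

(** With D = z d/dz and l = (D phi) u, which is nonnegative, the series u = 1 /
(1 - phi) solves D u = l u. Its m-th root is therefore the solution of D a = (l
/ m) a with a 0 = 1, a recursion with nonnegative weights; and both a^m and u
solve D x = l x with x 0 = 1, an equation with a unique solution. *)
Lemma renewal_root (phi u : nat -> R) (m : nat) : (0 < m)%N ->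
  phi 0 = 0 -> (forall k, 0 <= phi k) ->
  (forall k, u k = seq_delta k + (phi ** u) k) ->
  exists a, (forall k, 0 <= a k) /\ iter m (seq_conv a) seq_delta = u.
Proof.
move=> m0 phi0 phige0 uE.
have u0 := renewal_ge0 phi0 phige0 uE.
pose l := euler_deriv phi ** u.
have l0 k : 0 <= l k.
  by apply: seq_conv_ge0 => // i; rewrite mulr_ge0.
have l00 : l 0 = 0 by rewrite /l seq_conv_recl ?big_ord0// /euler_deriv mul0r.
have uS : u = fun k => seq_delta k + (phi ** u) k by apply/funext.
have dux k : euler_deriv u k = l k + (phi ** euler_deriv u) k.
  rewrite {1}/euler_deriv uE -/(euler_deriv (phi ** u) k) mulrDr.
  rewrite -/(euler_deriv (phi ** u) k) euler_derivM {1}/seq_delta.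
  by case: k => [|k]; rewrite ?mul0r ?mulr0 add0r.
(* D u and l u both solve x = l + phi x, whose solution is unique. *)
have luE k : (l ** u) k = l k + (phi ** (l ** u)) k.
  rewrite {1}seq_convC {1}uS seq_convDl seq_conv0f; congr (_ + _).
  by rewrite -seq_convA (seq_convC u).
have du : euler_deriv u = l ** u.
  apply/funext => k; have [n] := ubnP k; elim: n k => // n ih k kn.
  rewrite dux luE !seq_conv_recl//; congr (_ + _); apply: eq_bigr => i _.
  by rewrite ih//; have := ltn_ord i; lia.
have [a [a0 aS]] := weighted_recursion
  (fun k i => l i.+1 / (m%:R * k.+1%:R)).
have age0 k : 0 <= a k.
  have [n] := ubnP k; elim: n k => // n ih [|k] kn; first by rewrite a0.
  rewrite aS sumr_ge0// => i _.
  by rewrite mulr_ge0 ?divr_ge0 ?mulr_ge0 ?ler0n// ih//; have := ltn_ord i; lia.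
have mn0 : m%:R != 0 :> R by rewrite pnatr_eq0 -lt0n.
have da k : euler_deriv a k = m%:R^-1 * (l ** a) k.
  rewrite seq_conv_recl// /euler_deriv; case: k => [|k].
    by rewrite big_ord0 mul0r mulr0.
  rewrite aS !big_distrr/=; apply: eq_bigr => i _.
  have kn0 : k.+1%:R != 0 :> R by rewrite pnatr_eq0.
  by rewrite subSS; field; rewrite nat1r kn0 mn0.
exists a; split => //.
have dpow j k : euler_deriv (iter j (seq_conv a) seq_delta) k =
    j%:R / m%:R * (l ** iter j (seq_conv a) seq_delta) k.
  elim: j k => [|j ih] k.
    by rewrite !mul0r /= /euler_deriv /seq_delta; case: k => [|k]; rewrite ?mul0r ?mulr0.
  set X := iter j _ _ in ih *.
  rewrite [iter j.+1 _ _]/= -/X euler_derivM.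
  have -> : euler_deriv a = fun k => m%:R^-1 * (l ** a) k by apply/funext.
  rewrite seq_convZl [a ** _]seq_convC.
  have -> : euler_deriv X = fun k => j%:R / m%:R * (l ** X) k by apply/funext.
  rewrite seq_convZl -!seq_convA (seq_convC X a) -natr1; ring.
set X := iter m _ _.
have X0 : X 0%N = 1.
  have H j : iter j (seq_conv a) seq_delta 0%N = 1.
    by elim: j => [|j ih] //=; rewrite /seq_conv big_ord1 subn0 a0 ih mulr1.
  exact: H.
apply/funext => k; have [n] := ubnP k; elim: n k => // n ih [|k] kn.
  by rewrite X0 uE seq_conv_recl// big_ord0 addr0.
have kn0 : k.+1%:R != 0 :> R by rewrite pnatr_eq0.
apply: (mulfI kn0); rewrite -/(euler_deriv X k.+1) -/(euler_deriv u k.+1).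
rewrite dpow -/X divff// mul1r du !seq_conv_recl//; apply: eq_bigr => i _.
by rewrite ih//; have := ltn_ord i; lia.
Qed.

End SequenceConvolution.

(** * Tails with log-convex decrements *)

Section ConvexTail.
Context {R : realType}.

Definition decrement (s : nat -> R) (k : nat) : R := s k - s k.+1.

(** The last clause says that s tends to 0, since s is nonincreasing. *)
Definition log_convex_tail (s : nat -> R) : Prop :=
  [/\ 0 < s 0, forall k, 0 <= s k, forall k, 0 <= decrement s k,
      forall k, decrement s k.+1 ^+ 2 <= decrement s k * decrement s k.+2 &
      forall e, 0 < e -> exists n, s n < e].

Variable s : nat -> R.
Hypothesis hs : log_convex_tail s.
Local Notation d := (decrement s).

Lemma tail_noninc m n : (m <= n)%N -> s n <= s m.
Proof.
case: hs => _ _ d0 _ _; elim: n => [|n ih]; first by rewrite leqn0 => /eqP ->.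
rewrite leq_eqVlt => /predU1P[->//|mn].
by rewrite (le_trans _ (ih mn))// -subr_ge0; exact: d0.
Qed.

(** A log-convex sequence of nonnegative reals that vanishes somewhere vanishes
from its second term on; and a tail that is constant from 1 on tends to 0 only
if that constant is 0. *)
Lemma tail_dichotomy : (forall k, s k.+1 = 0) \/ (forall k, 0 < d k).
Proof.
case: hs => s0 sge0 dge0 dlc slim.
have [d1|d1] := ltP 0 (d 1).
  right; suff H k : 0 < d k /\ 0 < d k.+1 by move=> k; have [] := H k.
  elim: k => [|k [dk dk1]].
    split => //; rewrite lt_neqAle dge0 andbT eq_sym; apply/eqP => d00.
    by have := dlc 0; rewrite d00 mul0r leNgt exprn_gt0.
  split => //; rewrite lt_neqAle dge0 andbT eq_sym; apply/eqP => dk2.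
  by have := dlc k; rewrite dk2 mulr0 leNgt exprn_gt0.
left; have dS k : d k.+1 = 0.
  elim: k => [|k ih]; first by apply/eqP; rewrite eq_le d1 dge0.
  apply/eqP; rewrite -sqrf_eq0 eq_le sqr_ge0 andbT.
  by have := dlc k.+1; rewrite ih mul0r.
have cst k : s k.+1 = s 1%N.
  by elim: k => // k <-; apply/eqP; rewrite eq_sym -subr_eq0; apply/eqP/dS.
suff s10 : s 1%N = 0 by move=> k; rewrite cst.
apply/eqP; rewrite eq_le sge0 andbT leNgt; apply/negP => /slim[n].
by rewrite -(cst n) ltNge tail_noninc.
Qed.

Hypothesis dgt0 : forall k, 0 < d k.

Lemma tail_gt0 k : 0 < s k.
Proof.
case: hs => _ sge0 _ _ _.
by rewrite (le_lt_trans (sge0 k.+1))// -subr_gt0; exact: dgt0.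
Qed.

(** Log-convexity says that the ratios u k.+1 / u k are nondecreasing. *)
Lemma cross_mono (u : nat -> R) : (forall k, 0 < u k) ->
  (forall k, u k.+1 ^+ 2 <= u k * u k.+2) ->
  forall j k, (j <= k)%N -> u j.+1 * u k <= u k.+1 * u j.
Proof.
move=> u0 uc j; elim=> [|k ih]; first by rewrite leqn0 => /eqP ->.
rewrite leq_eqVlt => /predU1P[->//|jk].
rewrite -(ler_pM2r (u0 k)).
have := ler_wpM2r (ltW (u0 k.+1)) (ih jk); have := ler_wpM2r (ltW (u0 j)) (uc k).
lra.
Qed.

Lemma decrement_ratio j k : (j <= k)%N -> d j.+1 * d k <= d k.+1 * d j.
Proof. by apply: cross_mono => //; case: hs. Qed.

(* Partial sums, over the indices j from k to N - 1, of the nonnegative terms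
   d k * d j.+1 - d k.+1 * d j; they increase to d k * s k.+1 - d k.+1 * s k. *)
Let T k N := d k * (s k.+1 - s N.+1) - d k.+1 * (s k - s N).

Let T_succ k N : T k N.+1 - T k N = d N.+1 * d k - d k.+1 * d N.
Proof. rewrite /T /decrement; ring. Qed.

Let T_nd k m n : (k <= m)%N -> (m <= n)%N -> T k m <= T k n.
Proof.
move=> km; elim: n => [|n ih]; first by rewrite leqn0 => /eqP ->.
rewrite leq_eqVlt => /predU1P[->//|mn]; rewrite (le_trans (ih mn))//.
by rewrite -subr_ge0 T_succ subr_ge0 decrement_ratio// (leq_trans km).
Qed.

Let T_le k N : (k <= N)%N -> T k N <= d k * s k.+1 - d k.+1 * s k.
Proof.
case: hs => _ sge0 _ _ slim kN; apply/ler_addgt0Pr => e e0.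
have [n sn] := slim _ (divr_gt0 e0 (dgt0 k.+1)).
rewrite (le_trans (T_nd kN (leq_addr n N)))//.
have snN : s (N + n)%N < e / d k.+1.
  by rewrite (le_lt_trans _ sn)// tail_noninc// leq_addl.
have := mulr_ge0 (ltW (dgt0 k)) (sge0 (N + n).+1).
move: snN; rewrite ltr_pdivlMr// /T; lra.
Qed.

Let T_ge0 k N : (k <= N)%N -> 0 <= T k N.
Proof.
move=> kN; rewrite (le_trans _ (T_nd (leqnn k) kN))//.
by rewrite /T /decrement; lra.
Qed.

Lemma tail_decrement_ratio k : d k.+1 * s k <= d k * s k.+1.
Proof. by rewrite -subr_ge0 (le_trans (T_ge0 (leqnn k)))// T_le. Qed.

Lemma decrement_lt k : d k.+1 < d k.
Proof.
rewrite -(ltr_pM2r (tail_gt0 k)) (le_lt_trans (tail_decrement_ratio k))//.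
by rewrite ltr_pM2l// -subr_gt0; exact: dgt0.
Qed.

Lemma tail_log_convex k : s k.+1 ^+ 2 <= s k * s k.+2.
Proof. by have := tail_decrement_ratio k; rewrite /decrement; lra. Qed.

Lemma tail_ratio j k : (j <= k)%N -> s j.+1 * s k <= s k.+1 * s j.
Proof. by apply: cross_mono; [exact: tail_gt0 | exact: tail_log_convex]. Qed.

(** Equality in the log-convexity of s at k forces every term of the series
that represents the defect to vanish, so the decrements, and with them s, are
geometric from k on. *)
Lemma tail_geometric k : s k * s k.+2 <= s k.+1 ^+ 2 ->
  forall n, (k <= n)%N -> s n.+1 * s k = s k.+1 * s n.
Proof.
move=> eqk; have L0 : d k * s k.+1 - d k.+1 * s k <= 0.
  by move: eqk; rewrite /decrement; lra.
have L0' : d k * s k.+1 = d k.+1 * s k.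
  by apply/eqP; rewrite eq_le -subr_le0 L0 tail_decrement_ratio.
move=> n kn; have : T k n = 0.
  by apply/eqP; rewrite eq_le T_ge0// andbT (le_trans (T_le kn)).
rewrite /T => Tn.
have dkn : d k * s n.+1 = d k.+1 * s n by lra.
have dk0 : d k != 0 by rewrite gt_eqF.
by apply: (mulfI dk0); rewrite !mulrA dkn L0'; ring.
Qed.

End ConvexTail.

(** * Toeplitz systems of a sequence with log-convex decrements *)

Section Levinson.
Context {R : realType}.
Implicit Types (p : int -> R) (a b : nat -> R).

Definition right_tail p (k : nat) : R := p k%:Z.
Definition left_tail p (k : nat) : R := p (- k%:Z).
Definition reflect p (x : int) : R := p (- x).

(** The left-hand side of the k-th equation of the Toeplitz system of p. *)
Definition residual p a (n : nat) (k : int) : R :=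
  \sum_(i < n.+1) a i * p (k - i%:Z).

Lemma reflectK p : reflect (reflect p) = p.
Proof. by apply/funext => x; rewrite /reflect opprK. Qed.

Lemma right_tail_reflect p : right_tail (reflect p) = left_tail p.
Proof. by []. Qed.

Lemma left_tail_reflect p : left_tail (reflect p) = right_tail p.
Proof. by apply/funext => k; rewrite /left_tail /reflect opprK. Qed.

(** Differences of p turn the system for p into one for its decrements, which
have opposite signs on the two sides of the origin. *)
Lemma residual_second_difference p a n (k : int) (lam : R) :
  \sum_(i < n.+1) a i * ((p (k - i%:Z) - p (k + 1 - i%:Z)) -
     lam * (p (k - 1 - i%:Z) - p (k - i%:Z))) =
  (residual p a n k - residual p a n (k + 1)) -
  lam * (residual p a n (k - 1) - residual p a n k).
Proof.
rewrite /residual -!sumrB mulr_sumr -sumrB; apply: eq_bigr => i _; ring.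
Qed.

Section Positivity.
Variable p : int -> R.
Hypothesis hr : log_convex_tail (right_tail p).
Hypothesis hl : log_convex_tail (left_tail p).
Local Notation r := (right_tail p).
Local Notation l := (left_tail p).
Local Notation d := (decrement (right_tail p)).
Local Notation dl := (decrement (left_tail p)).

(** Take equation k minus equation k + 1, and subtract lam times the same
expression for k - 1 and k. With lam the ratio of two successive decrements the
term i = 0 cancels (for k = 1, where lam is 0, it is positive). By
log-convexity of the decrements the coefficient of a i is <= 0 for 0 < i < k,
and it is < 0 for i > k because decrements strictly decrease. If a k = 0, all
terms of the sum are thus nonnegative, while the equations make the sum
nonpositive; so every term is zero, the last one included. *)
Lemma zero_propagates a N k :
  (forall k, 0 < d k) -> (forall k, 0 < dl k) ->
  a 0 = 1 -> (forall i, (0 < i <= N)%N -> a i <= 0) ->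
  (forall j : nat, (0 < j < N)%N -> residual p a N j%:Z = 0) ->
  0 <= residual p a N N%:Z ->
  (0 < k < N)%N -> a k = 0 -> a N = 0.
Proof.
move=> dgt0 dlgt0 a0 ale0 res0 resN /andP[k0 kN] ak0.
have dm := decrement_ratio hr dgt0.
(* Equation 0 is not part of the system, so it must not enter when k = 1. *)
pose lam := if k == 1%N then 0 else d k / d k.-1.
have lam0 : 0 <= lam by rewrite /lam; case: ifP => // _; rewrite divr_ge0// ltW.
have lam1 : lam < 1.
  rewrite /lam; case: ifP => // k1; rewrite ltr_pdivrMr// mul1r.
  by rewrite -{1}(prednK k0); exact: decrement_lt.
pose c (i : nat) := (p (k%:Z - i%:Z) - p (k%:Z + 1 - i%:Z)) -
  lam * (p (k%:Z - 1 - i%:Z) - p (k%:Z - i%:Z)).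
have cN i : (k < i)%N -> c i < 0.
  move=> ki; have [j ij] : exists j, i = (k + j).+1 by exists (i - k.+1)%N; lia.
  have -> : c i = lam * dl j.+1 - dl j.
    rewrite /c /decrement /left_tail ij.
    rewrite (_ : k%:Z - (k + j).+1%:Z = - j.+1%:Z); last lia.
    rewrite (_ : k%:Z + 1 - (k + j).+1%:Z = - j%:Z); last lia.
    rewrite (_ : k%:Z - 1 - (k + j).+1%:Z = - j.+2%:Z); last lia.
    ring.
  rewrite subr_lt0 (lt_trans _ (decrement_lt hl dlgt0 j))// gtr_pMl//.
have c_lt i : (i < k)%N -> c i = d (k - i)%N - lam * d (k - i).-1.
  move=> ik; rewrite /c /decrement /right_tail.
  rewrite (_ : k%:Z - i%:Z = (k - i)%N%:Z); last lia.
  rewrite (_ : k%:Z + 1 - i%:Z = (k - i).+1%:Z); last lia.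
  rewrite (_ : k%:Z - 1 - i%:Z = (k - i).-1%:Z); last lia.
  by rewrite (_ : (k - i).-1.+1 = (k - i)%N); last lia.
have term_ge0 (i : 'I_N.+1) : 0 <= a i * c i.
  have [ik|ki|->] := ltngtP i k; last by rewrite ak0 mul0r.
    rewrite c_lt//; have [->|i0] := posnP i.
      rewrite a0 mul1r subn0 /lam; case: ifP => _; first by rewrite mul0r subr0 ltW.
      by rewrite divfK ?subrr// gt_eqF.
    have k1 : (k == 1%N) = false by apply/negbTE; lia.
    rewrite mulr_le0// ?ale0//; first by have := ltn_ord i; lia.
    rewrite /lam k1 subr_le0 mulrAC ler_pdivlMr//.
    have := @dm (k - i).-1 k.-1; rewrite !prednK; [|lia|lia].
    by apply; lia.
  rewrite mulr_le0// ?ale0//; first by have := ltn_ord i; lia.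
  exact/ltW/cN.
have sum_le0 : \sum_(i < N.+1) a i * c i <= 0.
  rewrite residual_second_difference res0 ?k0// sub0r.
  have -> : lam * (residual p a N (k%:Z - 1) - 0) = 0.
    rewrite subr0 /lam; case: eqP => [_|k1]; first by rewrite mul0r.
    rewrite (_ : k%:Z - 1 = k.-1%:Z); last lia.
    by rewrite res0 ?mulr0//; lia.
  rewrite subr0 oppr_le0 (_ : k%:Z + 1 = k.+1%:Z); last lia.
  move: kN; rewrite leq_eqVlt => /predU1P[->//|kN].
  by rewrite res0.
have sum0 : \sum_(i < N.+1) a i * c i = 0.
  by apply/eqP; rewrite eq_le sum_le0 sumr_ge0.
have /(_ ord_max isT)/eqP := psumr_eq0P (fun i _ => term_ge0 i) sum0.
by rewrite mulf_eq0 (lt_eqF (cN _ kN)) orbF => /eqP.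
Qed.


Lemma forward_residual_termE n i : (i <= n)%N ->
  r n * p (n.+1%:Z - i%:Z) - r n.+1 * p (n%:Z - i%:Z) =
  r n * r (n - i).+1 - r n.+1 * r (n - i)%N.
Proof.
move=> i_n; rewrite /right_tail.
rewrite (_ : n%:Z - i%:Z = (n - i)%N%:Z); last lia.
by rewrite (_ : n.+1%:Z - i%:Z = (n - i).+1%:Z); last lia.
Qed.

(** Comparing equation n + 1 with equation n times the ratio r n.+1 / r n
cancels the term i = 0, as in Kaluza's argument for one-sided sequences. *)
Lemma forward_residualE a n :
  \sum_(i < n.+1) a i * (r n * r (n - i).+1 - r n.+1 * r (n - i)%N) =
  r n * residual p a n n.+1%:Z - r n.+1 * residual p a n n%:Z.
Proof.
rewrite /residual !mulr_sumr -sumrB; apply: eq_bigr => i _.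
rewrite -forward_residual_termE; last by rewrite -ltnS.
ring.
Qed.

Lemma forward_term_ge0 a n i : (forall k, 0 < d k) -> a 0 = 1 ->
  (forall i, (0 < i)%N -> a i <= 0) -> (i <= n)%N ->
  0 <= a i * (r n * r (n - i).+1 - r n.+1 * r (n - i)%N).
Proof.
move=> dgt0 a0 ale0 i_n; have [->|i0] := posnP i.
  by rewrite subn0 a0 mul1r mulrC subrr.
rewrite mulr_le0 ?ale0// subr_le0 mulrC.
by apply: tail_ratio => //; lia.
Qed.

Lemma forward_residual_ge0 a n : (forall k, 0 < d k) -> a 0 = 1 ->
  (forall i, (0 < i)%N -> a i <= 0) ->
  (forall j : nat, (0 < j <= n)%N -> residual p a n j%:Z = 0) ->
  0 <= residual p a n n.+1%:Z.
Proof.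
move=> dgt0 a0 ale0 res0; have rgt0 := tail_gt0 hr dgt0.
case: n res0 => [|n] res0.
  by rewrite /residual big_ord1 a0 mul1r subr0; exact/ltW/rgt0.
have := forward_residualE a n.+1; rewrite (res0 n.+1) ?leqnn// mulr0 subr0 => E.
rewrite -(pmulr_rge0 _ (rgt0 n.+1)) -E; apply: sumr_ge0 => i _.
by apply: forward_term_ge0 => //; rewrite -ltnS.
Qed.

(** If the n-th coefficient vanishes, equations n - 1 and n compared as above
give a vanishing sum of nonnegative terms. For i >= 1, each a i != 0 then
equates two ratios of consecutive values of r, hence makes r geometric from n -
1 - i on, and equation n + 1 holds with the same coefficients. *)
Lemma forward_residual_eq0 a n : (forall k, 0 < d k) -> a 0 = 1 ->
  (forall i, (0 < i)%N -> a i <= 0) ->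
  residual p a n n%:Z = 0 -> residual p a n n.-1%:Z = 0 -> (1 < n)%N ->
  a n = 0 -> residual p a n n.+1%:Z = 0.
Proof.
move=> dgt0 a0 ale0 resn resn1 n1 an0; have rgt0 := tail_gt0 hr dgt0.
case: n n1 an0 resn resn1 => // n n0 an0 resn resn1.
have trunc (k : int) : residual p a n k = residual p a n.+1 k.
  by rewrite /residual [RHS]big_ord_recr/= an0 mul0r addr0.
have E : \sum_(i < n.+1) a i * (r n * r (n - i).+1 - r n.+1 * r (n - i)%N) = 0.
  by rewrite forward_residualE !trunc resn resn1 !mulr0 subrr.
have sgn (i : 'I_n.+1) : true ->
    0 <= a i * (r n * r (n - i).+1 - r n.+1 * r (n - i)%N).
  by move=> _; apply: forward_term_ge0 => //; rewrite -ltnS.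
have term0 := psumr_eq0P sgn E.
have := forward_residualE a n.+1; rewrite resn mulr0 subr0 => E'.
apply: (mulfI (lt0r_neq0 (rgt0 n.+1))); rewrite mulr0 -E'.
rewrite big_ord_recr/= an0 mul0r addr0; apply/big1 => i _.
have [i0|i0] := posnP i; first by rewrite i0 subn0 [r n.+1 * _]mulrC subrr mulr0.
have i_n : (i <= n)%N by rewrite -ltnS.
have /eqP := term0 i isT; rewrite mulf_eq0 => /predU1P[->|]; first by rewrite mul0r.
rewrite subr_eq0 => /eqP eqr.
have jn : ((n - i).+1 <= n)%N by lia.
have geo : r (n - i)%N * r (n - i).+2 <= r (n - i).+1 ^+ 2.
  rewrite -(ler_pM2r (rgt0 n)) -mulrA.
  have := tail_ratio hr dgt0 jn.
  move=> /(ler_wpM2l (ltW (rgt0 (n - i)%N))) /le_trans; apply.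
  by rewrite expr2 -(mulrA (r _)) (mulrC (r (n - i).+1) (r n)) eqr; lra.
have geoE := tail_geometric hr dgt0 geo.
apply/eqP; rewrite mulf_eq0; apply/orP; right; rewrite subr_eq0; apply/eqP.
apply: (mulIf (lt0r_neq0 (rgt0 (n - i)%N))).
rewrite (subSn i_n) -!mulrA.
have := geoE n.+1 ltac:(lia); have := geoE (n - i).+1 ltac:(lia) => -> e1.
by rewrite [X in _ = _ * X]mulrC [RHS]mulrA e1; ring.
Qed.

End Positivity.
End Levinson.

(** * Signs in a Levinson step *)

Section LevinsonStep.
Context {R : realType}.
Implicit Types (p : int -> R) (a b : nat -> R).

(** What is preserved along the recursion. The last clause is for a tail that
vanishes off the origin: the strict inequalities above fail there, but the
predictor is then trivial. *)
Definition admissible p n a : Prop :=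
  [/\ a 0 = 1, forall i, (0 < i)%N -> a i <= 0, forall i, (n < i)%N -> a i = 0,
      forall j : nat, (0 < j <= n)%N -> residual p a n j%:Z = 0 &
      (forall k, right_tail p k.+1 = 0) -> forall i, (0 < i)%N -> a i = 0].

(** A step of Levinson's recursion with a free parameter; one value of kappa
solves equation n + 1, and the smaller ones form the path to it. *)
Definition levinson_comb a b n (kappa : R) (i : nat) : R :=
  a i - kappa * (if (i <= n.+1)%N then b (n.+1 - i)%N else 0).

(** Reversal exchanges p and its reflection; so equations 1, ..., n are kept,
and only equations 0 and n + 1 move with kappa. *)
Lemma residual_comb p a b n kappa (k : int) :
  a n.+1 = 0 -> b n.+1 = 0 ->
  residual p (levinson_comb a b n kappa) n.+1 k =
  residual p a n k - kappa * residual (reflect p) b n (n.+1%:Z - k).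
Proof.
move=> an bn.
have -> : residual p a n k = residual p a n.+1 k.
  by rewrite /residual [RHS]big_ord_recr/= an mul0r addr0.
have -> : residual (reflect p) b n (n.+1%:Z - k) =
    residual (reflect p) b n.+1 (n.+1%:Z - k).
  by rewrite /residual [RHS]big_ord_recr/= bn mul0r addr0.
rewrite /residual [X in _ = _ - _ * X](reindex_inj rev_ord_inj)/= mulr_sumr -sumrB.
apply: eq_bigr => i _; have i_n : (i <= n.+1)%N by rewrite -ltnS.
rewrite /levinson_comb i_n subSS /reflect.
rewrite (_ : - (n.+1%:Z - k - (n.+1 - i)%N%:Z) = k - i%:Z); last lia.
ring.
Qed.

Section Step.
Variable p : int -> R.
Hypothesis hr : log_convex_tail (right_tail p).
Hypothesis hl : log_convex_tail (left_tail p).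

(** Subtracting equation 1 leaves the first decrement plus products of
nonpositive numbers. *)
Lemma admissible_zero_residual_gt0 n a : admissible p n a ->
  0 < residual p a n 0.
Proof.
case=> a0 ale0 atail ares _.
have p0 : 0 < p 0 by case: hr.
case: n ares atail => [|n] ares atail.
  by rewrite /residual big_ord1 a0 mul1r subr0.
have d0 : 0 < p 0 - p 1.
  have [z|] := tail_dichotomy hr; last by move/(_ 0%N).
  by have := z 0%N; rewrite /right_tail => ->; rewrite subr0.
rewrite (lt_le_trans d0)// -[leRHS]subr0 -(ares 1%N)// /residual -sumrB.
rewrite big_ord_recl/= a0 !mul1r !subr0 lerDl sumr_ge0// => i _.
rewrite -mulrBr mulr_le0 ?ale0// subr_le0 /bump/= add1n.
rewrite (_ : 0 - i.+1%:Z = - i.+1%:Z); last lia.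
rewrite (_ : 1%:Z - i.+1%:Z = - i%:Z); last lia.
by case: hl => _ _ /(_ i) + _ _; rewrite subr_ge0.
Qed.

Lemma forward_residual_admissible_ge0 n a : admissible p n a ->
  0 <= residual p a n n.+1%:Z.
Proof.
case=> a0 ale0 atail ares adeg.
have [z|dgt0] := tail_dichotomy hr; last exact: forward_residual_ge0.
rewrite /residual sumr_ge0// => i _; have [i0|i0] := posnP i.
  by rewrite i0 subr0; have := z n; rewrite /right_tail => ->; rewrite mulr0.
by rewrite adeg// mul0r.
Qed.

(** Suppose that some entry ends up positive. Replace kappa by theta * kappa,
where theta in [0, 1) is the first parameter at which such an entry reaches
zero. The combination is then still nonpositive, and one of its entries
vanishes, so [zero_propagates] shows that its last entry, - theta * kappa, is
zero. Hence theta = 0: an entry of a itself is zero, so a n = 0 by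
[zero_propagates] again, and [forward_residual_eq0] gives kappa = 0, in which
case nothing has moved. *)
Lemma levinson_comb_le0 n a b : admissible p n a ->
  admissible (reflect p) n b ->
  residual p a n 0 = residual (reflect p) b n 0 ->
  let kappa := residual p a n n.+1%:Z / residual p a n 0 in
  forall i, (0 < i)%N -> levinson_comb a b n kappa i <= 0.
Proof.
move=> ha hb sE kappa.
have s0 := admissible_zero_residual_gt0 ha.
have e0 := forward_residual_admissible_ge0 ha.
have kappa0 : 0 <= kappa by rewrite divr_ge0// ltW.
have [a0 ale0 atail ares adeg] := ha.
have [b0 ble0 btail bres bdeg] := hb.
move=> i i0; rewrite leNgt; apply/negP => ci.
have i_n : (i <= n)%N.
  rewrite leqNgt; apply/negP => ni; move: ci.
  rewrite /levinson_comb atail// sub0r oppr_gt0; case: ifP => ii.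
    by rewrite (_ : (n.+1 - i)%N = 0%N) ?b0 ?mulr1 ?ltNge ?kappa0//; clear -ni; lia.
  by rewrite mulr0 ltxx.
have [z|dgt0] := tail_dichotomy hr.
  move: ci; rewrite (_ : kappa = 0) ?/levinson_comb ?mul0r ?subr0 ?ltNge ?ale0//.
  rewrite /kappa /residual big1 ?mul0r// => j _; have [j0|j0] := posnP j.
    by rewrite j0 subr0; have := z n; rewrite /right_tail => ->; rewrite mulr0.
  by rewrite adeg// mul0r.
have [z|dlgt0] := tail_dichotomy hl.
  move: ci; rewrite /levinson_comb (bdeg _ (n.+1 - i)%N); last by rewrite subn_gt0 ltnS.
    by rewrite if_same mulr0 subr0 ltNge ale0.
  by rewrite right_tail_reflect.
pose P (j : 'I_n.+1) := (0 < j)%N && (0 < levinson_comb a b n kappa j).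
(* The value of theta at which entry j crosses zero. *)
pose F (j : 'I_n.+1) := a j / (kappa * b (n.+1 - j)%N).
pose i1 : 'I_n.+1 := Ordinal (i_n : (i < n.+1)%N).
have Pi1 : P i1 by rewrite /P i0 ci.
have combE (j : nat) t : (j <= n)%N ->
    levinson_comb a b n t j = a j - t * b (n.+1 - j)%N.
  by move=> jn; rewrite /levinson_comb (leq_trans jn).
have [/= k /andP[k0 ck] kmin] := @arg_minP _ R 'I_n.+1 i1 P F Pi1.
have kn : (k <= n)%N by rewrite -ltnS.
have kb_lt0 (j : nat) : (0 < j <= n)%N -> 0 < levinson_comb a b n kappa j ->
    kappa * b (n.+1 - j)%N < 0.
  move=> /andP[j0 jn]; rewrite combE// subr_gt0 => /lt_le_trans; apply.
  exact: ale0.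
have kbk : kappa * b (n.+1 - k)%N < 0 by rewrite kb_lt0// k0.
have kappagt0 : 0 < kappa.
  by rewrite lt_neqAle kappa0 andbT; apply: contraTneq kbk => <-; rewrite mul0r ltxx.
set theta := F k in kmin.
have theta0 : 0 <= theta by rewrite /theta /F mulr_le0// ?ale0// invr_le0 ltW.
have theta1 : theta < 1.
  by move: ck; rewrite combE// subr_gt0 /theta /F ltr_ndivrMr// mul1r.
set t := theta * kappa.
have ctk : levinson_comb a b n t k = 0.
  rewrite combE// /t -mulrA /theta /F divfK ?subrr// lt_eqF//.
have ct0 : levinson_comb a b n t 0 = 1.
  by rewrite /levinson_comb subn0 a0 btail// mulr0 subr0.
have ctN : levinson_comb a b n t n.+1 = - t.
  by rewrite /levinson_comb leqnn subnn b0 mulr1 atail// sub0r.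
have t0 : 0 <= t by rewrite mulr_ge0.
have ct_le0 (j : nat) : (0 < j <= n.+1)%N -> levinson_comb a b n t j <= 0.
  move=> /andP[j0]; rewrite leq_eqVlt => /predU1P[->|]; first by rewrite ctN oppr_le0.
  rewrite ltnS => jn; rewrite combE//.
  have [cj|cj] := leP (levinson_comb a b n kappa j) 0.
    rewrite (_ : _ - _ = (1 - theta) * a j + theta * levinson_comb a b n kappa j).
      rewrite -[leRHS]addr0 lerD//; last by rewrite mulr_ge0_le0.
      by rewrite mulr_ge0_le0 ?ale0// subr_ge0 ltW.
    by rewrite combE// /t; ring.
  have := kmin (Ordinal (jn : (j < n.+1)%N)); rewrite /P/= j0 cj => /(_ isT).
  rewrite /F/= ler_ndivlMr; last by rewrite kb_lt0// j0.
  by rewrite /t -mulrA subr_le0.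
have resE (x : int) : residual p (levinson_comb a b n t) n.+1 x =
    residual p a n x - t * residual (reflect p) b n (n.+1%:Z - x).
  by apply: residual_comb; [exact: atail|exact: btail].
have ct_res (j : nat) : (0 < j < n.+1)%N ->
    residual p (levinson_comb a b n t) n.+1 j%:Z = 0.
  move=> /andP[j0]; rewrite ltnS => jn; rewrite resE ares ?j0//.
  rewrite subzn ?(leqW jn)//.
  by rewrite bres ?mulr0 ?subrr//; clear -j0 jn; lia.
have ct_resN : 0 <= residual p (levinson_comb a b n t) n.+1 n.+1%:Z.
  rewrite resE subrr -sE /t /kappa -mulrA divfK ?gt_eqF//.
  by rewrite -[X in X - _]mul1r -mulrBl mulr_ge0// subr_ge0 ltW.
have kN : (0 < k < n.+1)%N by rewrite k0 ltnS.
have := zero_propagates hr hl dgt0 dlgt0 ct0 ct_le0 ct_res ct_resN kN ctk.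
move/eqP; rewrite ctN oppr_eq0 mulf_eq0 (gt_eqF kappagt0) orbF => /eqP theta_eq0.
have ak : a k = 0.
  by move: ctk; rewrite combE// /t theta_eq0 !mul0r subr0.
have an : a n = 0.
  move: kn; rewrite leq_eqVlt => /predU1P[<-//|kn].
  apply: (@zero_propagates R p hr hl a n k) => //.
  - by move=> j /andP[j0 _]; exact: ale0.
  - by move=> j /andP[j0 jn]; apply: ares; rewrite j0 ltnW.
  - by rewrite ares ?leqnn ?andbT// (leq_ltn_trans (leq0n k)).
  - by rewrite k0.
have n0 : (0 < n)%N by exact: leq_trans i0 i_n.
(* For n = 1 the only equation reads p 1 + a 1 * p 0 = 0. *)
have n1 : (1 < n)%N.
  rewrite ltn_neqAle n0 andbT; apply/eqP => n1; move: an (ares 1%N).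
  rewrite -n1 /residual !big_ord_recr big_ord0/= => -> /(_ isT).
  rewrite a0 add0r mul0r addr0 mul1r => /eqP; apply/negP.
  by rewrite gt_eqF// (tail_gt0 hr dgt0 1).
have : kappa = 0.
  rewrite /kappa (forward_residual_eq0 hr dgt0 a0)// ?mul0r//.
  - by rewrite ares// n0 leqnn.
  - by rewrite ares//; clear -n1; lia.
by move/eqP; rewrite gt_eqF.
Qed.

End Step.
End LevinsonStep.

(** * Levinson recursion and its limit *)

Section LevinsonRecursion.
Context {R : realType}.
Implicit Types (p : int -> R) (a b : nat -> R).

Definition levinson_step p n a b : nat -> R :=
  levinson_comb a b n (residual p a n n.+1%:Z / residual p a n 0).

Lemma admissible_levinson_step p n a b :
  log_convex_tail (right_tail p) -> log_convex_tail (left_tail p) ->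
  admissible p n a -> admissible (reflect p) n b ->
  residual p a n 0 = residual (reflect p) b n 0 ->
  admissible p n.+1 (levinson_step p n a b).
Proof.
move=> hr hl ha hb sE.
have s0 := admissible_zero_residual_gt0 hr hl ha.
have neg := levinson_comb_le0 hr hl ha hb sE.
have [a0 ale0 atail ares adeg] := ha.
have [b0 ble0 btail bres bdeg] := hb.
have an : a n.+1 = 0 by exact: atail.
have bn : b n.+1 = 0 by exact: btail.
split => //.
- by rewrite /levinson_step /levinson_comb subn0 a0 bn mulr0 subr0.
- move=> i ni; rewrite /levinson_step /levinson_comb leqNgt ni mulr0 subr0.
  by rewrite atail// ltnW.
- move=> j /andP[j0]; rewrite /levinson_step leq_eqVlt => /predU1P[->|].
    by rewrite residual_comb// subrr -sE divfK ?subrr// gt_eqF.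
  rewrite ltnS => jn; rewrite residual_comb// ares ?j0//.
  rewrite (_ : n.+1%:Z - j%:Z = (n.+1 - j)%N%:Z); last lia.
  by rewrite bres ?mulr0 ?subrr//; lia.
- move=> z i i0; rewrite /levinson_step.
  rewrite /levinson_comb adeg// sub0r [X in X / _](_ : _ = 0) ?mul0r ?mul0r ?oppr0//.
  rewrite /residual big1// => j _; have [j0|j0] := posnP j.
    by rewrite j0 subr0; have := z n; rewrite /right_tail => ->; rewrite mulr0.
  by rewrite adeg// mul0r.
Qed.

Fixpoint levinson p n : (nat -> R) * (nat -> R) :=
  if n is m.+1 then
    let: (a, b) := levinson p m in
    (levinson_step p m a b, levinson_step (reflect p) m b a)
  else (seq_delta, seq_delta).

Lemma admissible_seq_delta p : admissible p 0 seq_delta.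
Proof.
by split => // [[]//|[]//|j|_ []//]; case: j.
Qed.

Lemma levinson_admissible p n :
  log_convex_tail (right_tail p) -> log_convex_tail (left_tail p) ->
  [/\ admissible p n (levinson p n).1,
   admissible (reflect p) n (levinson p n).2 &
   residual p (levinson p n).1 n 0 = residual (reflect p) (levinson p n).2 n 0].
Proof.
move=> hr hl; have hr' : log_convex_tail (right_tail (reflect p)) by [].
have hl' : log_convex_tail (left_tail (reflect p)) by rewrite left_tail_reflect.
elim: n => [|n]; first by split; try exact: admissible_seq_delta;
  rewrite /residual !big_ord1 /reflect !subr0 oppr0.
rewrite /=; case: (levinson p n) => a b /= [ha hb sE]; split.
- exact: admissible_levinson_step.
- by apply: admissible_levinson_step => //; rewrite reflectK.
have [_ _ atail _ _] := ha; have [_ _ btail _ _] := hb.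
rewrite /levinson_step !residual_comb ?atail ?btail// reflectK !subr0 -sE.
by rewrite mulrC mulrA mulrAC.
Qed.

(** The limit, as n grows, of the n-th order systems; the third clause is what
remains at the limit of the positivity of the residual at 0. *)
Definition predictor p (f : nat -> R) : Prop :=
  [/\ f 0 = 0, forall i, 0 <= f i <= 1,
      forall M, \sum_(i < M) f i * p (0 - i%:Z) <= p 0 &
      forall x : nat, (0 < x)%N ->
        series (fun i : nat => f i * p (x%:Z - i%:Z)) @ \oo --> p x%:Z].

Section Predictor.
Variable p : int -> R.
Hypothesis hr : log_convex_tail (right_tail p).
Hypothesis hl : log_convex_tail (left_tail p).

Let phi n i := if i == 0%N then 0 else - (levinson p n).1 i.

Lemma tail_le0 (x : int) : p x <= p 0.
Proof.
case: x => n; first exact: (tail_noninc hr (leq0n n)).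
by have := tail_noninc hl (leq0n n.+1); rewrite /left_tail oppr0 NegzE.
Qed.

Lemma tail_ge0 (x : int) : 0 <= p x.
Proof.
case: x => n; first by case: hr => _ /(_ n).
by case: hl => _ /(_ n.+1); rewrite /left_tail NegzE.
Qed.

Let phi_ge0 n i : 0 <= phi n i.
Proof.
rewrite /phi; case: eqP => // /eqP; rewrite -lt0n => i0.
have [[_ ale0 _ _ _] _ _] := levinson_admissible n hr hl.
by rewrite oppr_ge0 ale0.
Qed.

Let phi_sum n (x : int) : \sum_(i < n.+1) phi n i * p (x - i%:Z) =
  p x - residual p (levinson p n).1 n x.
Proof.
have [[a0 _ _ _ _] _ _] := levinson_admissible n hr hl.
rewrite /residual !big_ord_recl/= a0 subr0 mul1r mul0r add0r opprD addrA subrr.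
by rewrite add0r -sumrN; apply: eq_bigr => i _; rewrite mulNr.
Qed.

Let phi_sumS n (x : nat) : (0 < x <= n)%N ->
  \sum_(i < n.+1) phi n i * p (x%:Z - i%:Z) = p x%:Z.
Proof.
have [[_ _ _ ares _] _ _] := levinson_admissible n hr hl.
by move=> xn; rewrite phi_sum ares// subr0.
Qed.

Let phi_sum0 n : \sum_(i < n.+1) phi n i * p (0 - i%:Z) <= p 0.
Proof.
have [ha _ _] := levinson_admissible n hr hl.
by rewrite phi_sum gerBl ltW// (admissible_zero_residual_gt0 hr hl ha).
Qed.

(** Equation i of the system, of which only the term i is kept. *)
Let phi_le n i : phi n i * p 0 <= p i%:Z.
Proof.
have [->|i0] := posnP i; first by rewrite /phi mul0r tail_ge0.
have [i_n|ni] := leqP i n; last first.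
  have [[_ _ atail _ _] _ _] := levinson_admissible n hr hl.
  by rewrite /phi gtn_eqF// atail// oppr0 mul0r tail_ge0.
rewrite -(@phi_sumS n i) ?i0//.
rewrite (bigD1 (Ordinal (i_n : (i < n.+1)%N)))//= subrr lerDl.
by apply: sumr_ge0 => j _; rewrite mulr_ge0 ?phi_ge0 ?tail_ge0.
Qed.

Let phi_noninc i m n : (i <= m)%N -> (m <= n)%N -> phi n i <= phi m i.
Proof.
move=> im; elim: n => [|n ih]; first by rewrite leqn0 => /eqP ->.
rewrite leq_eqVlt => /predU1P[->//|mn]; rewrite (le_trans _ (ih mn))//.
rewrite /phi; case: eqP => // /eqP; rewrite -lt0n => i0.
have [ha [b0 ble0 _ _ _] _] := levinson_admissible n hr hl.
have s0 := admissible_zero_residual_gt0 hr hl ha.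
have e0 := forward_residual_admissible_ge0 hr ha.
rewrite lerN2 /=; case: (levinson p n) ha ble0 s0 e0 => a b /= ha ble0 s0 e0.
rewrite /levinson_step /levinson_comb lerDl oppr_ge0 mulr_ge0_le0//.
  by rewrite divr_ge0// ltW.
by case: ifP => // _; rewrite ble0//; lia.
Qed.

Let phi_cvg i : cvgn (fun n => phi n i).
Proof.
apply: (@near_nonincreasing_is_cvgn _ _ 0); last exact: nearW.
near=> m => n mn; apply: phi_noninc => //; near: m; exact: nbhs_infty_ge.
Unshelve. all: by end_near. Qed.

(** Dominated convergence by hand: the terms of the n-th equation are bounded
by those of the convergent series of r, so the sum up to M differs from p x by
at most the remainder of that series. *)
Lemma limit_predictor : cvgn (series (right_tail p)) ->
  exists f, predictor p f.
Proof.
move=> cr; pose f i := limn (fun n => phi n i).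
have flim i : phi n i @[n --> \oo] --> f i by exact: phi_cvg.
have f0 i : 0 <= f i by apply: limr_ge; [exact: phi_cvg|exact: nearW].
have sumlim (x : int) M : \sum_(i < M) phi n i * p (x - i%:Z) @[n --> \oo] -->
    \sum_(i < M) f i * p (x - i%:Z).
  elim: M => [|M ih].
    rewrite big_ord0; under eq_fun do rewrite big_ord0; exact: cvg_cst.
  rewrite big_ord_recr; under eq_fun do rewrite big_ord_recr.
  by apply: cvgD ih _; apply: cvgMl; exact: flim.
have summono n M (x : int) : (M <= n.+1)%N ->
    \sum_(i < M) phi n i * p (x - i%:Z) <=
    \sum_(i < n.+1) phi n i * p (x - i%:Z).
  move=> Mn; rewrite (big_ord_widen _ (fun i => phi n i * p (x - i%:Z)) Mn).
  rewrite [leRHS](bigID (fun i : 'I__ => i < M)%N)/= lerDl sumr_ge0// => i _.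
  by rewrite mulr_ge0 ?phi_ge0 ?tail_ge0.
have p0 : 0 < p 0 by case: hr.
exists f; split => //.
- by rewrite /f /phi; apply: lim_cst.
- move=> i; rewrite f0/=; apply: limr_le; [exact: phi_cvg|apply: nearW => n].
  rewrite -(ler_pM2r p0) mul1r (le_trans (phi_le n i))//; exact: tail_le0.
- move=> M; apply: (cvgr_to_le (sumlim 0 M)).
  near=> n; apply: le_trans (phi_sum0 n); apply: summono.
  by apply: leqW; near: n; exact: nbhs_infty_ge.
- move=> x x0; pose L := limn (series (right_tail p)).
have upper M : p x%:Z <= \sum_(i < M) f i * p (x%:Z - i%:Z) +
    (L - series (right_tail p) M).
  rewrite -lerBlDr; apply: (cvgr_to_ge (sumlim x%:Z M)).
  near=> n; have Mn : (M <= n.+1)%N by apply: leqW; near: n; exact: nbhs_infty_ge.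
  rewrite lerBlDr -(@phi_sumS n x); last first.
    by rewrite x0; near: n; exact: nbhs_infty_ge.
  rewrite -(big_mkord xpredT (fun i => phi n i * p (x%:Z - i%:Z))).
  rewrite -(big_mkord xpredT (fun i => phi n i * p (x%:Z - i%:Z))).
  rewrite (big_cat_nat _ Mn)//= lerD2l lerBrDl.
  apply: (@le_trans _ _ (series (right_tail p) n.+1)); last first.
    apply: nondecreasing_cvgn_le => //; apply: nondecreasing_series => i *.
    by case: hr.
  rewrite /series/= [leRHS](big_cat_nat _ Mn)//= lerD2l; apply: ler_sum => i _.
  by rewrite (le_trans _ (phi_le n i))// ler_wpM2l ?phi_ge0 ?tail_le0.
have lower M : \sum_(i < M) f i * p (x%:Z - i%:Z) <= p x%:Z.
  apply: (cvgr_to_le (sumlim x%:Z M)); near=> n.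
  rewrite -[leRHS](@phi_sumS n x); last first.
    by rewrite x0; near: n; exact: nbhs_infty_ge.
  by apply: summono; apply: leqW; near: n; exact: nbhs_infty_ge.
apply: (@squeeze_cvgr _ _ _ _ (fun M => p x%:Z - (L - series (right_tail p) M))
  (fun=> p x%:Z)).
- apply: nearW => M; rewrite {2 3}/series/= big_mkord.
  by rewrite lerBlDr upper lower.
- rewrite -[X in _ --> X]subr0; apply: cvgB; first exact: cvg_cst.
  by rewrite -(subrr L); apply: cvgB => //; exact: cvg_cst.
- exact: cvg_cst.
Unshelve. all: by end_near. Qed.

End Predictor.
End LevinsonRecursion.

(** * Sequences as one-sided functions on the integers *)

Section Lift.
Context {R : realType}.
Local Open Scope ereal_scope.
Local Notation "f ** g" := (@int_conv R f g) (at level 40, left associativity).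

Definition lift (f : nat -> R) (x : int) : \bar R :=
  if x is Posz k then (f k)%:E else 0.

Definition flip (f : int -> \bar R) (x : int) : \bar R := f (- x)%R.

Lemma lift_ge0 f : (forall k, (0 <= f k)%R) -> forall x, 0 <= lift f x.
Proof. by move=> f0 [k|k] //=; rewrite lee_fin. Qed.

Lemma int_conv_flip f g : flip (f ** g) = flip f ** flip g.
Proof.
apply/funext => x; rewrite /flip /int_conv esum_reflect; apply: eq_esum => y _.
by congr (_ * g _); rewrite opprB opprK addrC.
Qed.

(** A factor carried by nat turns the sum over the integers into a series,
which can be cut at a finite index. *)
Lemma int_conv_lift f g x : (forall k, (0 <= f k)%R) -> (forall y, 0 <= g y) ->
  (lift f ** g) x = \sum_(i <oo) ((f i)%:E * g (x - i%:Z)%R).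
Proof.
move=> f0 g0; rewrite nneseries_esumT; last first.
  by move=> i; rewrite mule_ge0// lee_fin.
rewrite /int_conv -(esum_image _ Posz (fun y => lift f y * g (x - y)%R)); last first.
  by move=> i j _ _ [].
rewrite [RHS]esum_mkcond; apply: eq_esum => -[k|k] _ /=.
  by rewrite mem_set//; exists k.
by rewrite mul0e; case: ifP.
Qed.

Lemma lift_seq_delta : lift seq_delta = int_delta.
Proof. by apply/funext => -[[|k]|k]. Qed.

Lemma lift_seq_conv f g :
  (forall k, (0 <= f k)%R) -> (forall k, (0 <= g k)%R) ->
  lift (seq_conv f g) = lift f ** lift g.
Proof.
move=> f0 g0; apply/funext => x; rewrite int_conv_lift//; last exact: lift_ge0.
have term0 i : 0 <= (f i)%:E * lift g (x - i%:Z)%R.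
  by rewrite mule_ge0 ?lee_fin ?lift_ge0.
have negE (y : int) : (y < 0)%R -> lift g y = 0 by case: y.
case: x term0 => [k|k] term0; last first.
  by rewrite eseries0// => i _ _; rewrite negE ?mule0//; lia.
rewrite (nneseries_split 0%N k.+1)//= add0n.
rewrite [X in _ + X]eseries0 ?adde0; last first.
  by move=> i ki _; rewrite negE ?mule0//; lia.
rewrite big_mkord /seq_conv -sumEFin; apply: eq_bigr => i _.
rewrite (_ : k%:Z - i%:Z = (k - i)%N%:Z)%R//; have := ltn_ord i; lia.
Qed.

Lemma lift_iter f m : (forall k, (0 <= f k)%R) ->
  lift (iter m (seq_conv f) seq_delta) = int_conv_pow (lift f) m.
Proof.
move=> f0; elim: m => [|m ih]; first exact: lift_seq_delta.
rewrite /= lift_seq_conv// ?ih//.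
elim: m {ih} => [|m ih] /=; first by move=> k; rewrite ler0n.
exact: seq_conv_ge0.
Qed.

Lemma flip_int_conv_pow f m : flip (int_conv_pow f m) = int_conv_pow (flip f) m.
Proof.
elim: m => [|m ih]; last by rewrite /= int_conv_flip ih.
by apply/funext => x; rewrite /flip /= /int_delta oppr_eq0.
Qed.

Lemma int_conv_powZ (c : R) f m : (0 <= c)%R -> (forall x, 0 <= f x) ->
  int_conv_pow (fun x => c%:E * f x) m =
  fun x => (c ^+ m)%:E * int_conv_pow f m x.
Proof.
move=> c0 f0; elim: m => [|m ih].
  by apply/funext => x; rewrite expr0 mul1e.
rewrite /= -/(int_conv_pow _ _) ih -/(int_conv_pow _ _).
rewrite int_convZl ?lee_fin// => [|x]; last first.
  by rewrite mule_ge0 ?lee_fin ?exprn_ge0// int_conv_pow_ge0.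
apply/funext => x; rewrite int_convC int_convZl//.
- by rewrite muleA -EFinM -exprS int_convC.
- by rewrite lee_fin exprn_ge0.
- exact: int_conv_pow_ge0.
Qed.

End Lift.

(** * Wiener-Hopf factorization *)

Section Factorization.
Context {R : realType}.
Local Open Scope ereal_scope.
Local Notation "f ** g" := (@int_conv R f g) (at level 40, left associativity).

Variables (p : int -> R) (hp : int_distribution p).

Let P x := (p x)%:E.
Let P0 x : 0 <= P x. Proof. by rewrite lee_fin hp.1. Qed.

Let P_mass_shift (x : int) : \esum_(y in [set: int]) P (x - y)%R = 1.
Proof.
rewrite -hp.2 esum_reflect (esum_translate _ (- x)%R); apply: eq_esum => y _.
by congr P; lia.
Qed.

Let int_conv_bounded f x : (forall y, 0 <= f y <= 1) -> (f ** P) x <= 1.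
Proof.
move=> f01; rewrite -(P_mass_shift x) /int_conv; apply: le_esum => y _.
have /andP[f0 f1] := f01 y.
by rewrite -[leRHS]mul1e lee_wpmul2r.
Qed.

Lemma int_conv_fin f x : (forall y, 0 <= f y <= 1) -> (f ** P) x \is a fin_num.
Proof.
move=> f01; rewrite ge0_fin_numE; last first.
  by apply: int_conv_ge0 => // y; have /andP[] := f01 y.
by rewrite (le_lt_trans (int_conv_bounded x f01))// ltry.
Qed.

Section OneSided.
Variable f : nat -> R.
Hypothesis hf : predictor p f.

Let fge0 i : (0 <= f i)%R. Proof. by case: hf => _ /(_ i)/andP[]. Qed.

Let f01 y : 0 <= lift f y <= 1.
Proof. by case: y => k /=; rewrite ?lee01 ?lexx// !lee_fin; case: hf. Qed.

Lemma predictor_int_conv (x : int) : (0 < x)%R -> (lift f ** P) x = P x.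
Proof.
case: x => // n n0; rewrite int_conv_lift//.
have [_ _ _ /(_ _ n0) fc] := hf.
rewrite [RHS](_ : _ = (limn (series
  (fun i : nat => f i * p (n%:Z - i%:Z))%R))%:E); last by rewrite (cvg_lim _ fc).
rewrite -EFin_lim; last by apply/cvg_ex; exists (p n%:Z).
by apply: congr_lim; apply/funext => m /=; rewrite /series/= -sumEFin.
Qed.

(** Only an inequality holds at 0: the difference will be the constant sigma of
the factorization. *)
Lemma predictor_int_conv0 : (lift f ** P) 0%R <= P 0%R.
Proof.
rewrite int_conv_lift//; apply: lime_le.
  by apply: is_cvg_nneseries => i _ _; rewrite mule_ge0// lee_fin.
apply: nearW => m; rewrite big_mkord.
by have [_ _ /(_ m) + _] := hf; rewrite -lee_fin -sumEFin.
Qed.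

Lemma predictor_fin x : (lift f ** P) x \is a fin_num.
Proof. exact: int_conv_fin. Qed.

(** The recursion of u is the equation of p truncated to nonnegative indices,
so u k * p 0 <= p k by induction. *)
Lemma renewal_le1 u : (forall x, (p x <= p 0)%R) -> (0 < p 0)%R ->
  (forall k, u k = seq_delta k + seq_conv f u k)%R ->
  forall k, (u k <= 1)%R.
Proof.
have [ff0 ff1 _ fc] := hf.
move=> p_le p0gt0 uE; have u0 := renewal_ge0 ff0 fge0 uE.
suff H k : (u k * p 0 <= p k%:Z)%R.
  by move=> k; rewrite -(ler_pM2r p0gt0) mul1r (le_trans (H k)).
have [n] := ubnP k; elim: n k => // n ih [|k] kn.
  by rewrite uE seq_conv_recl// big_ord0 addr0 mul1r.
have fck := fc k.+1 isT.
apply: (@le_trans _ _ (series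
    (fun i : nat => f i * p (k.+1%:Z - i%:Z))%R k.+2)); last first.
  rewrite -(cvg_lim _ fck)//; apply: nondecreasing_cvgn_le.
    apply: nondecreasing_series => i *; rewrite mulr_ge0//; exact: hp.1.
  by apply/cvg_ex; eexists; exact: fck.
rewrite uE add0r seq_conv_recl// /series/= big_mkord [leRHS]big_ord_recl/=.
rewrite ff0 mul0r add0r big_distrl/=; apply: ler_sum => i _.
rewrite -mulrA ler_wpM2l// /bump/= add1n.
have ik := ltn_ord i.
rewrite (le_trans (ih (k.+1 - i.+1)%N _))//; first by lia.
by rewrite (_ : (k.+1 - i.+1)%N%:Z = k.+1%:Z - i.+1%:Z)%R//; lia.
Qed.

End OneSided.
End Factorization.

Section WienerHopf.
Context {R : realType}.
Local Open Scope ereal_scope.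
Local Notation "f ** g" := (@int_conv R f g) (at level 40, left associativity).

Lemma int_distribution_reflect (p : int -> R) :
  int_distribution p -> int_distribution (reflect p).
Proof.
move=> [p0 p1]; split; first by move=> x; exact: p0.
by rewrite -p1 [RHS]esum_reflect.
Qed.

Variables (p : int -> R) (phi psi : nat -> R).
Hypothesis hp : int_distribution p.
Hypothesis p_le : forall x, (p x <= p 0)%R.
Hypothesis p0gt0 : (0 < p 0)%R.
Hypothesis hphi : predictor p phi.
Hypothesis hpsi : predictor (reflect p) psi.

Let P x := (p x)%:E.
Let P0 x : 0 <= P x. Proof. by rewrite lee_fin hp.1. Qed.

Let phi0 i : (0 <= phi i)%R. Proof. by case: hphi => _ /(_ i)/andP[]. Qed.
Let psi0 i : (0 <= psi i)%R. Proof. by case: hpsi => _ /(_ i)/andP[]. Qed.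

Let hp' := int_distribution_reflect hp.
Let Phi := lift phi ** P.
Let Psi := flip (lift psi).
Let Psi0 x : 0 <= Psi x. Proof. exact: lift_ge0. Qed.
Let Phi0 x : 0 <= Phi x.
Proof. by apply: int_conv_ge0 => //; exact: lift_ge0. Qed.

Let right_predict (x : int) : (0 < x)%R -> Phi x = P x.
Proof. exact: predictor_int_conv. Qed.

Let left_predict (x : int) : (x < 0)%R -> (Psi ** P) x = P x.
Proof.
move=> x0; have xE : x = (- - x)%R by rewrite opprK.
rewrite {1}xE -/(flip (Psi ** P) (- x)%R) int_conv_flip.
have -> : flip Psi = lift psi by apply/funext => y; rewrite /Psi /flip opprK.
rewrite (_ : flip P = fun y => (reflect p y)%:E)//.
rewrite (predictor_int_conv hp' hpsi); last by rewrite oppr_gt0.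
by rewrite /reflect opprK.
Qed.

(* A point x - j with x < 0 <= j is still negative; so phi * p inherits the
   backward equation of p. *)
Let left_predict_Phi (x : int) : (x < 0)%R -> (Psi ** Phi) x = Phi x.
Proof.
move=> x0; have l0 := lift_ge0 phi0.
rewrite /Phi (int_convA Psi0 l0 P0) (int_convC Psi) -(int_convA l0 Psi0 P0).
rewrite /int_conv; apply: eq_esum => y _; rewrite -!/(int_conv _ _ _).
by case: y => k; rewrite /= ?mul0e// left_predict//; lia.
Qed.

Let tail_split (G : int -> \bar R) (k : nat) : (forall x, 0 <= G x) ->
  (Psi ** G) (- k%:Z)%R = \sum_(i < k.+1) ((psi i)%:E * G (- (k%:Z - i%:Z))%R) +
    \sum_(k.+1 <= i <oo) ((psi i)%:E * G (- (k%:Z - i%:Z))%R).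
Proof.
move=> G0; rewrite -/(flip (Psi ** G) k%:Z) int_conv_flip.
have -> : flip Psi = lift psi by apply/funext => y; rewrite /Psi /flip opprK.
rewrite int_conv_lift; [|exact: psi0|by move=> y; exact: G0].
rewrite (nneseries_split 0%N k.+1)//=.
  by rewrite add0n big_mkord.
by move=> i _; apply: mule_ge0; [rewrite lee_fin|exact: G0].
Qed.

(* The difference p - phi * p on the nonpositive side, as a sequence. *)
Let h (k : nat) : R := (p (- k%:Z) - fine (Phi (- k%:Z)%R))%R.

Let h_ge0 : (0 <= h 0)%R.
Proof.
rewrite /h oppr0 subr_ge0 -lee_fin fineK; last exact: (predictor_fin hp hphi).
exact: (predictor_int_conv0 hp hphi).
Qed.

Let Phi_fin x : Phi x \is a fin_num.
Proof. exact: (predictor_fin hp hphi). Qed.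

(* Both p and phi * p satisfy the backward equation, with the same terms at
   positive points; these infinite parts cancel in the difference. *)
Let h_rec (k : nat) : (0 < k)%N -> (h k = seq_conv psi h k)%R.
Proof.
move=> k0; have kneg : (- k%:Z < 0)%R by lia.
set T := \sum_(k.+1 <= i <oo) ((psi i)%:E * P (- (k%:Z - i%:Z))%R).
have TE : \sum_(k.+1 <= i <oo) ((psi i)%:E * Phi (- (k%:Z - i%:Z))%R) = T.
  rewrite /T !ereal_series; apply: eq_eseriesr => i ki; congr (_ * _).
  rewrite (_ : (- (k%:Z - i%:Z))%R = (i - k)%N%:Z%R); last lia.
  by rewrite right_predict//; lia.
have psiP := tail_split k P0; have psiPhi := tail_split k Phi0.
rewrite left_predict// -/T in psiP; rewrite left_predict_Phi// TE in psiPhi.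
have T0 : 0 <= T.
  by apply: nneseries_ge0 => i _ _; rewrite mule_ge0// lee_fin.
have Tfin : T \is a fin_num.
  rewrite ge0_fin_numE// (@le_lt_trans _ _ (P (- k%:Z)%R)) ?ltry// psiP leeDr//.
  by apply: sume_ge0 => i _; rewrite mule_ge0// lee_fin.
apply: EFin_inj; rewrite /h EFinB fineK// -/(P _) psiP psiPhi.
have -> : \sum_(i < k.+1) ((psi i)%:E * P (- (k%:Z - i%:Z))%R) =
    (\sum_(i < k.+1) psi i * p (- (k%:Z - i%:Z)))%R%:E.
  by rewrite -sumEFin.
have -> : \sum_(i < k.+1) ((psi i)%:E * Phi (- (k%:Z - i%:Z))%R) =
    (\sum_(i < k.+1) psi i * fine (Phi (- (k%:Z - i%:Z))%R))%R%:E.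
  by rewrite -sumEFin; apply: eq_bigr => i _; rewrite EFinM fineK.
rewrite -(fineK Tfin) -!EFinD; congr EFin.
rewrite opprD addrACA subrr addr0 -sumrB; apply: eq_bigr => i _.
rewrite -mulrBr; congr (_ * _)%R.
have ik := ltn_ord i.
by rewrite (_ : (k - i)%N%:Z = k%:Z - i%:Z)%R//; lia.
Qed.

Let h_renewal (v : nat -> R) :
  (forall k, v k = seq_delta k + seq_conv psi v k)%R ->
  forall k, (h k = h 0 * v k)%R.
Proof.
have psi00 : psi 0%N = 0%R by case: hpsi.
move=> vE k; have [n] := ubnP k; elim: n k => // n ih [|k] kn.
  by rewrite vE seq_conv_recl// big_ord0 addr0 mulr1.
rewrite h_rec// vE add0r !seq_conv_recl// big_distrr/=; apply: eq_bigr => i _.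
rewrite ih; last by rewrite subSS (leq_ltn_trans (leq_subr i k)).
exact: mulrCA.
Qed.

(** Here p = phi * p + h with h a multiple of the reflection of v. Convolving
with u = delta + phi * u yields u * p both as p + u * phi * p and as u * phi *
p + u * h; the finite term u * phi * p cancels. *)
Lemma wiener_hopf : exists sigma u v,
  [/\ (0 <= sigma)%R, forall k, (u k = seq_delta k + seq_conv phi u k)%R,
      forall k, (v k = seq_delta k + seq_conv psi v k)%R &
      P = fun x => sigma%:E * (lift u ** flip (lift v)) x].
Proof.
have phi00 : phi 0%N = 0%R by case: hphi.
have psi00 : psi 0%N = 0%R by case: hpsi.
have [u uE] := renewal_exists phi00; have [v vE] := renewal_exists psi00.
have u0 := renewal_ge0 phi00 phi0 uE; have v0 := renewal_ge0 psi00 psi0 vE.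
have u1 := renewal_le1 hp hphi p_le p0gt0 uE.
exists (h 0), u, v; split => //.
have lu0 := lift_ge0 u0; have lv0 := lift_ge0 v0; have lp0 := lift_ge0 phi0.
have flv0 x : 0 <= flip (lift v) x by exact: lv0.
pose V x := (h 0)%:E * flip (lift v) x.
have V0 x : 0 <= V x by rewrite mule_ge0 ?lee_fin.
have addsub (x y : \bar R) : x \is a fin_num -> y = x + (y - x).
  by move=> xfin; rewrite addeC subeK.
have PE : P = Phi \+ V.
  apply/funext => -[[|k]|k] /=.
  - rewrite /V /flip/= -EFinM -h_renewal// /h oppr0 EFinB fineK//.
    exact: addsub.
  - by rewrite /V /flip/= mule0 adde0 right_predict.
  rewrite NegzE /V /flip opprK /= -EFinM -h_renewal// /h EFinB fineK//.
  exact: addsub.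
have luE : lift u = int_delta \+ (lift phi ** lift u).
  rewrite -lift_seq_conv// -lift_seq_delta; apply/funext => -[k|k] /=.
    by rewrite uE -EFinD.
  by rewrite adde0.
have W1 : lift u ** P = P \+ (lift u ** Phi).
  rewrite {1}luE int_convC int_convDr//; [|exact: int_delta_ge0|exact: int_conv_ge0].
  rewrite (int_convC P int_delta) (int_conv0f P0).
  by rewrite [P ** _]int_convC (int_convC (lift phi)) -int_convA.
have W2 : lift u ** P = (lift u ** Phi) \+ (lift u ** V) by rewrite {1}PE int_convDr.
apply/funext => x.
have Wfin : (lift u ** Phi) x \is a fin_num.
  have Ufin : (lift u ** P) x \is a fin_num.
    apply: int_conv_fin => //.
    by move=> [k|k] /=; rewrite ?lexx ?lee01// !lee_fin u0 u1.
  by move: Ufin; rewrite W1 /= fin_numD => /andP[].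
have W12 : P x + (lift u ** Phi) x = (lift u ** V) x + (lift u ** Phi) x.
  by rewrite -[LHS]/((P \+ _) x) -W1 W2 /= addeC.
rewrite -[LHS](addeK _ Wfin) W12 addeK//.
by rewrite int_convC /V int_convZl// ?lee_fin// int_convC.
Qed.

End WienerHopf.

(** * Infinite divisibility *)

Section Roots.
Context {R : realType}.
Local Open Scope ereal_scope.
Local Notation "f ** g" := (@int_conv R f g) (at level 40, left associativity).

(** Rules out infinite mass as well. *)
Lemma mass1_root (x : \bar R) (m : nat) : (0 < m)%N -> 0 <= x ->
  x ^+ m = 1 -> x = 1.
Proof.
case: x => [r| |]//; last by case: m => // m _ _; rewrite expeS gt0_mulye// expe_gt0.
move=> m0; rewrite lee_fin => r0; rewrite -EFin_expe => -[/eqP].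
by rewrite pexpr_eq1// => /eqP ->.
Qed.

(** Each of the factors sigma, u and v of p has a nonnegative m-th root, and so
has p because convolution is commutative. *)
Lemma predictors_infinitely_divisible (p : int -> R) phi psi :
  int_distribution p -> (forall x, (p x <= p 0)%R) -> (0 < p 0)%R ->
  predictor p phi -> predictor (reflect p) psi ->
  infinitely_divisible (int_cdf p).
Proof.
move=> hp p_le p0gt0 hphi hpsi m m0.
have [s [u [v [s0 uE vE pE]]]] := wiener_hopf hp p_le p0gt0 hphi hpsi.
have [phi0 phi01 _ _] := hphi; have [psi0 psi01 _ _] := hpsi.
have phige0 i : (0 <= phi i)%R by have /andP[] := phi01 i.
have psige0 i : (0 <= psi i)%R by have /andP[] := psi01 i.
have [a [a0 aU]] := renewal_root m0 phi0 phige0 uE.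
have [b [b0 bV]] := renewal_root m0 psi0 psige0 vE.
pose c := (s `^ m%:R^-1)%R.
have cm : (c ^+ m = s)%R.
  by rewrite /c -powR_mulrn ?powR_ge0// -powRrM mulVf ?powRr1// pnatr_eq0 -lt0n.
have c0 : (0 <= c)%R by exact: powR_ge0.
have la0 := lift_ge0 a0; have lb0 := lift_ge0 b0.
have fb0 x : 0 <= flip (lift b) x by exact: lb0.
pose Q x := c%:E * (lift a ** flip (lift b)) x.
have ab0 := int_conv_ge0 la0 fb0.
have Q0 x : 0 <= Q x by rewrite mule_ge0 ?lee_fin.
have QP : int_conv_pow Q m = fun x => (p x)%:E.
  rewrite int_conv_powZ// cm int_conv_powM// -flip_int_conv_pow -!lift_iter// aU bV.
  by rewrite pE.
have Qmass : \esum_(x in [set: int]) Q x = 1.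
  apply: (mass1_root m0); first exact: esum_ge0.
  by rewrite -esum_int_conv_pow// QP hp.2.
pose q x := fine (Q x).
have qE : (fun x => (q x)%:E) = Q.
  apply/funext => x; rewrite fineK// ge0_fin_numE// (@le_lt_trans _ _ 1) ?ltry//.
  rewrite -Qmass -[leLHS](esum_set1 (Q0 x)) [leLHS]esum_mkcond.
  by apply: le_esum => y _; case: ifP.
have hq : int_distribution q.
  split; first by move=> x; rewrite fine_ge0.
  by rewrite -Qmass -qE.
exists (cdf_of hq).
have [r [_ rE]] := convolution_power_cdf hq m.-1.
rewrite prednK// => ->; congr int_cdf; apply/funext => x; apply: EFin_inj.
by rewrite -[LHS]/((fun x => (r x)%:E) x) rE prednK// qE QP.
Qed.

End Roots.

Section LogConvexDistributions.
Context {R : realType}.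

Lemma cvg_series_right_tail (p : int -> R) :
  int_distribution p -> cvgn (series (right_tail p)).
Proof.
move=> hp; apply: nondecreasing_is_cvgn.
  by apply: nondecreasing_series => i *; exact: hp.1.
exists 1 => _ [n _ <-]; rewrite -lee_fin /series/= -sumEFin -hp.2.
apply: (@le_trans _ _ (\sum_(i <oo) (p i%:Z)%:E)%E).
  by apply: nneseries_lim_ge => i _; rewrite lee_fin hp.1.
rewrite nneseries_esumT; last by move=> i; rewrite lee_fin hp.1.
rewrite -(esum_image _ Posz (fun y => (p y)%:E)); last by move=> i j _ _ [].
rewrite [leLHS]esum_mkcond; apply: le_esum => y _.
by case: ifP => // _; rewrite lee_fin hp.1.
Qed.

Lemma predictor_exists (p : int -> R) : int_distribution p ->
  log_convex_tail (right_tail p) -> log_convex_tail (left_tail p) ->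
  exists phi, predictor p phi.
Proof.
by move=> hp hr hl; apply: limit_predictor => //; exact: cvg_series_right_tail.
Qed.

Lemma log_convex_tails_infinitely_divisible (p : int -> R) :
  int_distribution p ->
  log_convex_tail (right_tail p) -> log_convex_tail (left_tail p) ->
  infinitely_divisible (int_cdf p).
Proof.
move=> hp hr hl; have [phi hphi] := predictor_exists hp hr hl.
have [psi hpsi] : exists psi, predictor (reflect p) psi.
  apply: predictor_exists; first exact: int_distribution_reflect.
    by [].
  by rewrite left_tail_reflect.
apply: (predictors_infinitely_divisible hp _ _ hphi hpsi).
  exact: tail_le0.
by case: hr.
Qed.

(** Consecutive sums differ by one v j, except that the first decrement may
exceed v 1; it only occurs on the larger side of the log-convexity inequality.
*)
Lemma log_convex_tail_sum (s v : nat -> R) (K : R) : 0 < K ->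
  (forall j, (0 < j)%N -> 0 <= v j) -> log_convex v ->
  (forall n, (0 < n)%N -> (K * s n)%:E = (\sum_(n.+1 <= j <oo) (v j)%:E)%E) ->
  (\sum_(1 <= j <oo) (v j)%:E <= (K * s 0%N)%:E)%E ->
  [/\ forall k, 0 <= decrement s k &
      forall k, decrement s k.+1 ^+ 2 <= decrement s k * decrement s k.+2].
Proof.
move=> K0 v0 vlc sE s0.
have split (n : nat) : (\sum_(n.+1 <= j <oo) (v j)%:E =
    (v n.+1)%:E + (K * s n.+1)%:E)%E.
  rewrite sE// (nneseries_split n.+1 1%N) ?addn1 ?big_nat1//.
  by move=> k nk; rewrite lee_fin v0// (leq_trans _ nk).
have dS n : K * decrement s n.+1 = v n.+2.
  apply: EFin_inj; rewrite /decrement mulrBr EFinB sE// split addeK//.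
have d0 : v 1%N <= K * decrement s 0.
  by move: s0; rewrite split -EFinD lee_fin /decrement mulrBr lerBrDr.
have vle n : v n.+1 <= K * decrement s n by case: n => [//|n]; rewrite dS.
split=> [k|k].
  by rewrite -(pmulr_rge0 _ K0) (le_trans _ (vle k))// v0.
have K2 : 0 < K ^+ 2 by rewrite exprn_gt0.
rewrite -(ler_pM2l K2) -exprMn dS (le_trans (vlc k.+1 isT))//.
rewrite expr2 mulrACA dS ler_wpM2r ?v0//.
Qed.

End LogConvexDistributions.

Theorem theorem3p1 (R : realType) (p : int -> R) (hp : int_distribution p)
    (K : R) (hK : 0 < K) (v : int -> R)
    (hv : forall j : int, j != 0 -> 0 <= v j)
    (hneg : log_convex (fun j : nat => v (- (j%:Z))))
    (hpos : log_convex (fun j : nat => v j%:Z))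
    (hpv : forall x : int, (K * p x)%:E =
       (if (x < 0)%R then \sum_(`|x|%N.+1 <= j <oo) (v (- (j%:Z))%R)%:E
        else if (0 < x)%R then \sum_(`|x|%N.+1 <= j <oo) (v j%:Z)%:E
        else maxe (\sum_(1 <= j <oo) (v (- (j%:Z))%R)%:E)
                  (\sum_(1 <= j <oo) (v j%:Z)%:E))%E) :
  infinitely_divisible (int_cdf p).
Proof.
have [rge0 rlc] : (forall k, 0 <= decrement (right_tail p) k) /\
    forall k, decrement (right_tail p) k.+1 ^+ 2 <=
      decrement (right_tail p) k * decrement (right_tail p) k.+2.
  apply: (log_convex_tail_sum hK _ hpos) => [j j0|n n0|].
  - by apply: hv; lia.
  - by rewrite /right_tail hpv/= ltz_nat n0.
  - by rewrite /right_tail hpv ltxx le_max lexx orbT.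
have [lge0 llc] : (forall k, 0 <= decrement (left_tail p) k) /\
    forall k, decrement (left_tail p) k.+1 ^+ 2 <=
      decrement (left_tail p) k * decrement (left_tail p) k.+2.
  apply: (log_convex_tail_sum hK _ hneg) => [j j0|n n0|].
  - by apply: hv; lia.
  - by rewrite /left_tail hpv (_ : (- n%:Z < 0) = true) ?abszN//; lia.
  - by rewrite /left_tail oppr0 hpv ltxx le_max lexx.
have r_noninc (s : nat -> R) : (forall k, 0 <= decrement s k) ->
    forall n, s n <= s 0%N.
  move=> d0; elim=> // n; apply: le_trans.
  by rewrite -subr_ge0; exact: d0.
have p_le (x : int) : p x <= p 0.
  case: x => n; first exact: (r_noninc (right_tail p)).
  by have := r_noninc (left_tail p) lge0 n.+1; rewrite /left_tail oppr0 NegzE.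
have p0gt0 : 0 < p 0.
  rewrite lt_neqAle hp.1 andbT eq_sym; apply/eqP => p00.
  have := hp.2; rewrite esum1 => [[/eqP]|x _]; first by rewrite eq_sym oner_eq0.
  by congr EFin; apply/eqP; rewrite eq_le hp.1 andbT -p00 p_le.
have small (q : int -> R) : int_distribution q -> forall e, 0 < e ->
    exists n, right_tail q n < e.
  move=> hq e e0.
  have /cvgrPdist_lt/(_ _ e0)[N _ /(_ N (leqnn N))] :=
    cvg_series_cvg_0 (cvg_series_right_tail hq).
  rewrite /= sub0r normrN ger0_norm; last exact: hq.1.
  by exists N.
apply: log_convex_tails_infinitely_divisible => //; split=> //.
- by move=> k; exact: hp.1.
- exact: small.
- by move=> k; exact: hp.1.
- exact: small (int_distribution_reflect hp).
Qed.
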